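(* Let $\mathcal F$ be a Frobenius category, $l\in\mathbb N$, and $s\in\{0,\dots,l-1\}$. The following cyclically ordered list of $2l+4$ triangulated subcategories is a $(2l+4)$-gon of recollements in $\mathcal M_l=\underline{\mathrm{Mor}}^{\mathrm m}_l(\mathcal F)$: $$\Gamma^{[0,s]},\ \ \underbrace{\Delta^{[k,k+s+1]},\ \Gamma^{[k+1,k+s+1]}}_{k=0,1,\dots,l-s-1},\ \ \Gamma^{[0,l-s-1]},\ \ \underbrace{\Delta^{[k,k+l-s]},\ \Gamma^{[k+1,k+l-s]}}_{k=0,1,\dots,s},$$ where under each brace the two displayed categories are listed, in this order, successively for increasing $k$ (so that the first group ends with $\Gamma^{[l-s,l]}$, and the second group ends with $\Gamma^{[s+1,l]}$, which is followed cyclically by $\Gamma^{[0,s]}$).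
   Context: Conventions: all subcategories are full and additive, functors are additive, and $\mathbb N$ contains $0$. A Frobenius category $\mathcal F$ is an exact category with enough projectives and enough injectives in which projective and injective objects coincide; its stable category $\underline{\mathcal F}$ is triangulated. For an exact category $\mathcal E$ and $l\in\mathbb N$, $\mathrm{Mor}^{\mathrm m}_l(\mathcal E)$ is the category of chains $X=(X,\alpha)\colon X^0\xrightarrow{\alpha^0}X^1\xrightarrow{\alpha^1}\cdots\xrightarrow{\alpha^{l-1}}X^l$ of $l$ admissible monomorphisms in $\mathcal E$, with commutative ladders as morphisms; it is exact with the termwise exact structure. If $\mathcal F$ is Frobenius, so is $\mathrm{Mor}^{\mathrm m}_l(\mathcal F)$, and its projective-injectives are the chains of admissible monomorphisms with all terms projective in $\mathcal F$. Its stable category is denoted $\mathcal M_l$. For $0\le s\le t\le l$: - $\Gamma^{[s,t]}\subseteq\mathcal M_l$ is the triangulated subcategory of all objects $X$ such that $X^k$ is projective in $\mathcal F$ for every $k\in\{0,\dots,s-1,t+1,\dots,l\}$. - $\Delta^{[s,t]}\subseteq\mathcal M_l$ is the triangulated subcategory of all objects isomorphic in $\mathcal M_l$ to a chain with $X^s=\cdots=X^t$ and $\alpha^s,\dots,\alpha^{t-1}$ identities. A semiorthogonal decomposition of a triangulated category $\mathcal T$ is a pair $(\mathcal U,\mathcal V)$ of triangulated subcategories such that $\mathrm{Hom}_{\mathcal T}(\mathcal U,\mathcal V)=0$ and each $T\in\mathcal T$ fits into a distinguished triangle $U\to T\to V\to\Sigma U$ with $U\in\mathcal U$, $V\in\mathcal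 V$. An $n$-gon of recollements ($n\ge2$) of $\mathcal T$ consists of triangulated subcategories $\mathcal U_1,\dots,\mathcal U_n$ such that $(\mathcal U_i,\mathcal U_{i+1})$ is a semiorthogonal decomposition of $\mathcal T$ for all $i\in\mathbb Z/n\mathbb Z$. *)

(* Defs.v *)
(* MathComp, with the classical axioms of mathcomp.classical.boolp. *)
From HB Require Import structures.
From mathcomp Require Import all_boot all_algebra.
From mathcomp Require Import boolp classical_sets.

Set Implicit Arguments.
Unset Strict Implicit.
Unset Printing Implicit Defensive.

Import GRing.Theory.
Local Open Scope ring_scope.
Local Open Scope quotient_scope.

(* Zero object and biproducts are chosen data; the remaining biproduct
   identities (prl inr = 0, prr inl = 0) follow from the three listed. *)
Record addCat := AddCat {
  Obj :> Type;
  Hom : Obj -> Obj -> zmodType;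
  idm : forall A, Hom A A;
  comp : forall A B D, Hom B D -> Hom A B -> Hom A D;
  compA : forall A B D E (h : Hom D E) (g : Hom B D) (f : Hom A B),
    comp h (comp g f) = comp (comp h g) f;
  comp1m : forall A B (f : Hom A B), comp (idm B) f = f;
  compm1 : forall A B (f : Hom A B), comp f (idm A) = f;
  compDl : forall A B D (g g' : Hom B D) (f : Hom A B),
    comp (g + g') f = comp g f + comp g' f;
  compDr : forall A B D (g : Hom B D) (f f' : Hom A B),
    comp g (f + f') = comp g f + comp g f';
  zob : Obj;
  zobP : idm zob = 0;
  biprod : Obj -> Obj -> Obj;
  inl_ : forall A B, Hom A (biprod A B);
  inr_ : forall A B, Hom B (biprod A B);
  prl : forall A B, Hom (biprod A B) A;
  prr : forall A B, Hom (biprod A B) B;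
  prl_inl : forall A B, comp (prl A B) (inl_ A B) = idm A;
  prr_inr : forall A B, comp (prr A B) (inr_ A B) = idm B;
  inl_prl_inr_prr : forall A B,
    comp (inl_ A B) (prl A B) + comp (inr_ A B) (prr A B) = idm (biprod A B)
}.
Arguments idm {a} A.
Arguments inl_ {a} A B.
Arguments inr_ {a} A B.
Arguments prl {a} A B.
Arguments prr {a} A B.
Arguments zob {a}.

Notation "g \oc f" := (comp g f) (at level 40, left associativity).

Section AddCatTheory.
Variable C : addCat.
Implicit Types A B D E : C.

Lemma comp0m A B D (f : Hom A B) : (0 : Hom B D) \oc f = 0.
Proof. by apply: (addrI (0 \oc f)); rewrite -compDl !addr0. Qed.

Lemma compm0 A B D (g : Hom B D) : g \oc (0 : Hom A B) = 0.
Proof. by apply: (addrI (g \oc 0)); rewrite -compDr !addr0. Qed.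

Lemma compNm A B D (g : Hom B D) (f : Hom A B) : (- g) \oc f = - (g \oc f).
Proof. by apply: (addrI (g \oc f)); rewrite -compDl !subrr comp0m. Qed.

Lemma compmN A B D (g : Hom B D) (f : Hom A B) : g \oc (- f) = - (g \oc f).
Proof. by apply: (addrI (g \oc f)); rewrite -compDr !subrr compm0. Qed.

Lemma prl_inr A B : prl A B \oc inr_ A B = 0.
Proof.
have : prl A B \oc (inl_ A B \oc prl A B + inr_ A B \oc prr A B) \oc inr_ A B
       = prl A B \oc inr_ A B by rewrite inl_prl_inr_prr compm1.
rewrite compDr !compA prl_inl comp1m compDl -(compA _ (prr A B)) prr_inr compm1.
by move=> /(canRL (addrK _)); rewrite subrr.
Qed.

Lemma prr_inl A B : prr A B \oc inl_ A B = 0.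
Proof.
have : prr A B \oc (inl_ A B \oc prl A B + inr_ A B \oc prr A B) \oc inl_ A B
       = prr A B \oc inl_ A B by rewrite inl_prl_inr_prr compm1.
rewrite compDr !compA prr_inr comp1m compDl -(compA _ (prl A B)) prl_inl compm1.
by move=> /(canRL (addKr _)); rewrite addNr.
Qed.

Definition is_iso A B (f : Hom A B) : Prop :=
  exists g : Hom B A, g \oc f = idm A /\ f \oc g = idm B.

Definition isomorphic A B : Prop := exists f : Hom A B, is_iso f.

(* Equality of objects is part of the assertion: the two endpoints coincide
   and the morphism is the identity. *)
Inductive is_idm A : forall B, Hom A B -> Prop :=
  IsIdm : is_idm (idm A).

Definition is_kernel A B D (f : Hom A B) (g : Hom B D) : Prop :=
  g \oc f = 0 /\
  forall T (x : Hom T B), g \oc x = 0 -> exists! h : Hom T A, f \oc h = x.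

Definition is_cokernel A B D (f : Hom A B) (g : Hom B D) : Prop :=
  g \oc f = 0 /\
  forall T (x : Hom B T), x \oc f = 0 -> exists! h : Hom D T, h \oc g = x.

Definition is_pushout A B A' D (f : Hom A B) (a : Hom A A')
    (b : Hom B D) (f' : Hom A' D) : Prop :=
  b \oc f = f' \oc a /\
  forall T (x : Hom B T) (y : Hom A' T), x \oc f = y \oc a ->
    exists! h : Hom D T, h \oc b = x /\ h \oc f' = y.

Definition is_pullback B D D' P (g : Hom B D) (d : Hom D' D)
    (b : Hom P B) (g' : Hom P D') : Prop :=
  g \oc b = d \oc g' /\
  forall T (x : Hom T B) (y : Hom T D'), g \oc x = d \oc y ->
    exists! h : Hom T P, b \oc h = x /\ g' \oc h = y.

Definition bisum A A' B B' (f : Hom A B) (g : Hom A' B') :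
    Hom (biprod A A') (biprod B B') :=
  inl_ B B' \oc f \oc prl A A' + inr_ B B' \oc g \oc prr A A'.

Lemma bisum_inl A A' B B' (f : Hom A B) (g : Hom A' B') :
  bisum f g \oc inl_ A A' = inl_ B B' \oc f.
Proof.
by rewrite /bisum compDl -2!(compA _ _ (inl_ A A')) prl_inl prr_inl compm1 compm0 addr0.
Qed.

Lemma bisum_inr A A' B B' (f : Hom A B) (g : Hom A' B') :
  bisum f g \oc inr_ A A' = inr_ B B' \oc g.
Proof.
by rewrite /bisum compDl -2!(compA _ _ (inr_ A A')) prl_inr prr_inr compm1 compm0 add0r.
Qed.

Lemma prl_bisum A A' B B' (f : Hom A B) (g : Hom A' B') :
  prl B B' \oc bisum f g = f \oc prl A A'.
Proof. by rewrite /bisum compDr !compA prl_inl prl_inr comp1m !comp0m addr0. Qed.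

Lemma prr_bisum A A' B B' (f : Hom A B) (g : Hom A' B') :
  prr B B' \oc bisum f g = g \oc prr A A'.
Proof. by rewrite /bisum compDr !compA prr_inl prr_inr comp1m !comp0m add0r. Qed.

Lemma biprod_ext A B D (f g : Hom (biprod A B) D) :
  f \oc inl_ A B = g \oc inl_ A B -> f \oc inr_ A B = g \oc inr_ A B -> f = g.
Proof.
move=> el er; rewrite -[f]compm1 -[g]compm1 -inl_prl_inr_prr !compDr !compA.
by rewrite el er.
Qed.

End AddCatTheory.

Definition seqClass (C : addCat) :=
  forall A B D : C, Hom A B -> Hom B D -> Prop.

Section Conflations.
Variables (C : addCat) (conf : seqClass C).

Definition inflation (A B : C) (f : Hom A B) : Prop :=
  exists (D : C) (g : Hom B D), conf f g.

Definition deflation (B D : C) (g : Hom B D) : Prop :=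
  exists (A : C) (f : Hom A B), conf f g.

Definition projective (P : C) : Prop :=
  forall (B D : C) (g : Hom B D), deflation g ->
  forall x : Hom P D, exists y : Hom P B, g \oc y = x.

Definition injective_ob (I : C) : Prop :=
  forall (A B : C) (f : Hom A B), inflation f ->
  forall x : Hom A I, exists y : Hom B I, y \oc f = x.

(* Quillen's axioms: conflations are a class of kernel-cokernel pairs closed
   under isomorphism; inflations (admissible monomorphisms) and deflations
   (admissible epimorphisms) contain the identities and are closed under
   composition, pushout and pullback respectively. *)
Record is_exact : Prop := IsExact {
  conf_ker : forall (A B D : C) (f : Hom A B) (g : Hom B D),
    conf f g -> is_kernel f g;
  conf_coker : forall (A B D : C) (f : Hom A B) (g : Hom B D),
    conf f g -> is_cokernel f g;
  conf_iso : forall (A B D A' B' D' : C) (f : Hom A B) (g : Hom B D)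
      (f' : Hom A' B') (g' : Hom B' D')
      (a : Hom A A') (b : Hom B B') (d : Hom D D'),
    is_iso a -> is_iso b -> is_iso d ->
    b \oc f = f' \oc a -> d \oc g = g' \oc b -> conf f g -> conf f' g';
  infl_id : forall A : C, inflation (idm A);
  defl_id : forall A : C, deflation (idm A);
  infl_comp : forall (A B D : C) (f : Hom A B) (g : Hom B D),
    inflation f -> inflation g -> inflation (g \oc f);
  defl_comp : forall (A B D : C) (f : Hom A B) (g : Hom B D),
    deflation f -> deflation g -> deflation (g \oc f);
  infl_push : forall (A B A' : C) (f : Hom A B) (a : Hom A A'), inflation f ->
    exists (D : C) (b : Hom B D) (f' : Hom A' D),
      is_pushout f a b f' /\ inflation f';
  defl_pull : forall (B D D' : C) (g : Hom B D) (d : Hom D' D), deflation g ->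
    exists (P : C) (b : Hom P B) (g' : Hom P D'),
      is_pullback g d b g' /\ deflation g'
}.

Definition enough_projectives : Prop :=
  forall X : C, exists (P : C) (p : Hom P X), projective P /\ deflation p.

Definition enough_injectives : Prop :=
  forall X : C, exists (I : C) (i : Hom X I), injective_ob I /\ inflation i.

End Conflations.

Record exactCat := ExactCat {
  ex_cat :> addCat;
  conf : seqClass ex_cat;
  exactP : is_exact conf
}.
Arguments conf {e} A B D _ _.

Definition frobenius (F : exactCat) : Prop :=
  [/\ enough_projectives (@conf F), enough_injectives (@conf F) &
      forall X : F, projective (@conf F) X <-> injective_ob (@conf F) X].

Section ExactTheory.
Variable E : exactCat.
Notation infl := (inflation (@conf E)).

Lemma infl_pushout (A B A' D : E) (f : Hom A B) (a : Hom A A')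
    (b : Hom B D) (f' : Hom A' D) :
  is_pushout f a b f' -> infl f -> infl f'.
Proof.
move=> [sq univ] inf.
have [D0 [b0 [f0 [[sq0 univ0] [G [g0 cg0]]]]]] := infl_push (exactP E) a inf.
have [c [[cb cf] _]] := univ0 _ _ _ sq.
have [c' [[c'b c'f] _]] := univ _ _ _ sq0.
have c'c : c' \oc c = idm D0.
  have [h [_ uh]] := univ0 _ _ _ sq0; rewrite -(uh (c' \oc c)).
    by apply: uh; rewrite !comp1m.
  by rewrite -!compA cb cf.
have cc' : c \oc c' = idm D.
  have [h [_ uh]] := univ _ _ _ sq; rewrite -(uh (c \oc c')).
    by apply: uh; rewrite !comp1m.
  by rewrite -!compA c'b c'f.
exists G, (g0 \oc c').
have idI (X : E) : is_iso (idm X) by exists (idm X); rewrite comp1m.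
have isoc : is_iso c by exists c'.
apply: (conf_iso (exactP E) (idI _) isoc (idI _) _ _ cg0).
- by rewrite compm1; exact: cf.
- by rewrite comp1m -compA c'c compm1.
Qed.

Lemma infl_bisum (A A' B B' : E) (f : Hom A B) (g : Hom A' B') :
  infl f -> infl g -> infl (bisum f g).
Proof.
move=> inf ing.
have -> : bisum f g = bisum (idm B) g \oc bisum f (idm A').
  apply: biprod_ext; first by rewrite -compA !bisum_inl compA bisum_inl compm1.
  by rewrite -compA !bisum_inr compA bisum_inr compm1.
apply: (infl_comp (exactP E)).
- apply: (infl_pushout (f := f) (a := inl_ A A') (b := inl_ B A')) => //.
  split=> [|T x y e]; first by rewrite bisum_inl.
  exists (x \oc prl B A' + y \oc inr_ A A' \oc prr B A'); split.
    split.
      rewrite compDl -2!(compA _ _ (inl_ B A')) prl_inl prr_inl.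
      by rewrite compm1 compm0 addr0.
    rewrite compDl -2!(compA _ _ (bisum _ _)) prl_bisum prr_bisum comp1m compA e.
    by rewrite -!compA -compDr inl_prl_inr_prr compm1.
  move=> h [hl hr]; apply: biprod_ext.
    rewrite hl compDl -2!(compA _ _ (inl_ B A')) prl_inl prr_inl.
    by rewrite compm1 compm0 addr0.
  rewrite compDl -2!(compA _ _ (inr_ B A')) prl_inr prr_inr compm1 compm0 add0r.
  by rewrite -hr -compA bisum_inr compm1.
- apply: (infl_pushout (f := g) (a := inr_ B A') (b := inr_ B B')) => //.
  split=> [|T x y e]; first by rewrite bisum_inr.
  exists (y \oc inl_ B A' \oc prl B B' + x \oc prr B B'); split.
    split.
      rewrite compDl -2!(compA _ _ (inr_ B B')) prl_inr prr_inr.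
      by rewrite compm1 compm0 add0r.
    rewrite compDl -2!(compA _ _ (bisum _ _)) prl_bisum prr_bisum comp1m.
    by rewrite (compA x) e -!compA -compDr inl_prl_inr_prr compm1.
  move=> h [hl hr]; apply: biprod_ext.
    rewrite compDl -2!(compA _ _ (inl_ B B')) prl_inl prr_inl compm1 compm0 addr0.
    by rewrite -hr -compA bisum_inl compm1.
  rewrite hl compDl -2!(compA _ _ (inr_ B B')) prl_inr prr_inr.
  by rewrite compm1 compm0 add0r.
Qed.

End ExactTheory.

(* Objects of Mor^m_l(E): the arrow alpha^k, k < l, goes from position
   [src k] = k to position [tgt k] = k + 1 of 'I_l.+1. *)
Section Chains.
Variables (E : exactCat) (l : nat).

Definition src (k : 'I_l) : 'I_l.+1 := widen_ord (leqnSn l) k.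
Definition tgt (k : 'I_l) : 'I_l.+1 := lift ord0 k.

Record chain := Chain {
  ch_ob :> 'I_l.+1 -> E;
  ch_map : forall k : 'I_l, Hom (ch_ob (src k)) (ch_ob (tgt k));
  ch_infl : forall k : 'I_l, inflation (@conf E) (ch_map k)
}.

Record ladder (X Y : chain) := Ladder {
  ld_map :> forall k : 'I_l.+1, Hom (X k) (Y k);
  ld_comm : forall k : 'I_l,
    ch_map Y k \oc ld_map (src k) = ld_map (tgt k) \oc ch_map X k
}.

HB.instance Definition _ X Y := gen_eqMixin (ladder X Y).
HB.instance Definition _ X Y := gen_choiceMixin (ladder X Y).

Lemma ladder_ext (X Y : chain) (f g : ladder X Y) : (forall k, f k = g k) -> f = g.
Proof.
case: f g => [f cf] [g cg] /= e.
have {e}e : f = g by apply: functional_extensionality_dep => k; apply: e.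
by case: _ / e cg => cg; rewrite (Prop_irrelevance cf cg).
Qed.

Fact ladder0_comm (X Y : chain) (k : 'I_l) :
  ch_map Y k \oc (0 : Hom (X (src k)) _) = (0 : Hom _ (Y (tgt k))) \oc ch_map X k.
Proof. by rewrite compm0 comp0m. Qed.
Definition ladder0 (X Y : chain) : ladder X Y :=
  @Ladder X Y (fun=> 0) (@ladder0_comm X Y).

Fact ladderN_comm (X Y : chain) (f : ladder X Y) (k : 'I_l) :
  ch_map Y k \oc (- f (src k)) = (- f (tgt k)) \oc ch_map X k.
Proof. by rewrite compmN compNm ld_comm. Qed.
Definition ladderN (X Y : chain) (f : ladder X Y) : ladder X Y :=
  @Ladder X Y (fun k => - f k) (ladderN_comm f).

Fact ladderD_comm (X Y : chain) (f g : ladder X Y) (k : 'I_l) :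
  ch_map Y k \oc (f (src k) + g (src k)) = (f (tgt k) + g (tgt k)) \oc ch_map X k.
Proof. by rewrite compDr compDl !ld_comm. Qed.
Definition ladderD (X Y : chain) (f g : ladder X Y) : ladder X Y :=
  @Ladder X Y (fun k => f k + g k) (ladderD_comm f g).

Fact ladder_addA X Y : associative (@ladderD X Y).
Proof. by move=> f g h; apply: ladder_ext => k /=; rewrite addrA. Qed.
Fact ladder_addC X Y : commutative (@ladderD X Y).
Proof. by move=> f g; apply: ladder_ext => k /=; rewrite addrC. Qed.
Fact ladder_add0 X Y : left_id (@ladder0 X Y) (@ladderD X Y).
Proof. by move=> f; apply: ladder_ext => k /=; rewrite add0r. Qed.
Fact ladder_addN X Y : left_inverse (@ladder0 X Y) (@ladderN X Y) (@ladderD X Y).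
Proof. by move=> f; apply: ladder_ext => k /=; rewrite addNr. Qed.

HB.instance Definition _ X Y := GRing.isZmodule.Build (ladder X Y)
  (@ladder_addA X Y) (@ladder_addC X Y) (@ladder_add0 X Y) (@ladder_addN X Y).

Fact ladder1_comm (X : chain) (k : 'I_l) :
  ch_map X k \oc idm (X (src k)) = idm (X (tgt k)) \oc ch_map X k.
Proof. by rewrite comp1m compm1. Qed.
Definition ladder1 (X : chain) : ladder X X :=
  @Ladder X X (fun k => idm (X k)) (ladder1_comm X).

Fact ladder_comp_comm (X Y Z : chain) (g : ladder Y Z) (f : ladder X Y) (k : 'I_l) :
  ch_map Z k \oc (g (src k) \oc f (src k)) = (g (tgt k) \oc f (tgt k)) \oc ch_map X k.
Proof. by rewrite compA ld_comm -compA ld_comm compA. Qed.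
Definition ladder_comp (X Y Z : chain) (g : ladder Y Z) (f : ladder X Y) : ladder X Z :=
  @Ladder X Z (fun k => g k \oc f k) (ladder_comp_comm g f).

Fact chain0_infl (k : 'I_l) : inflation (@conf E) (0 : Hom (@zob E) (@zob E)).
Proof. by rewrite -zobP; apply: (infl_id (exactP E)). Qed.
Definition chain0 : chain := @Chain (fun=> zob) _ chain0_infl.

Fact chain_biprod_infl (X Y : chain) (k : 'I_l) :
  inflation (@conf E) (bisum (ch_map X k) (ch_map Y k)).
Proof. by apply: infl_bisum; apply: ch_infl. Qed.
Definition chain_biprod (X Y : chain) : chain :=
  @Chain (fun k => biprod (X k) (Y k)) _ (chain_biprod_infl X Y).

Definition chain_inl (X Y : chain) : ladder X (chain_biprod X Y) :=
  @Ladder X (chain_biprod X Y) (fun k => inl_ (X k) (Y k))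
    (fun k => bisum_inl _ _).
Definition chain_inr (X Y : chain) : ladder Y (chain_biprod X Y) :=
  @Ladder Y (chain_biprod X Y) (fun k => inr_ (X k) (Y k))
    (fun k => bisum_inr _ _).
Definition chain_prl (X Y : chain) : ladder (chain_biprod X Y) X :=
  @Ladder (chain_biprod X Y) X (fun k => prl (X k) (Y k))
    (fun k => esym (prl_bisum _ _)).
Definition chain_prr (X Y : chain) : ladder (chain_biprod X Y) Y :=
  @Ladder (chain_biprod X Y) Y (fun k => prr (X k) (Y k))
    (fun k => esym (prr_bisum _ _)).

Definition chainCat : addCat.
Proof.
refine (@AddCat chain (fun X Y => ladder X Y : zmodType) ladder1 ladder_comp
  _ _ _ _ _ chain0 _ chain_biprod chain_inl chain_inr chain_prl chain_prr _ _ _).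
- by move=> X Y Z W h g f; apply: ladder_ext => k /=; rewrite compA.
- by move=> X Y f; apply: ladder_ext => k /=; rewrite comp1m.
- by move=> X Y f; apply: ladder_ext => k /=; rewrite compm1.
- by move=> X Y Z g g' f; apply: ladder_ext => k /=; rewrite compDl.
- by move=> X Y Z g f f'; apply: ladder_ext => k /=; rewrite compDr.
- by apply: ladder_ext => k /=; rewrite zobP.
- by move=> X Y; apply: ladder_ext => k /=; rewrite prl_inl.
- by move=> X Y; apply: ladder_ext => k /=; rewrite prr_inr.
- by move=> X Y; apply: ladder_ext => k /=; rewrite inl_prl_inr_prr.
Defined.

Definition chain_conf : seqClass chainCat :=
  fun X Y Z (f : ladder X Y) (g : ladder Y Z) => forall k, conf _ _ _ (f k) (g k).

End Chains.

Section StableCategory.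
Variables (C : addCat) (cf : seqClass C).

Definition factors_proj (X Y : C) (f : Hom X Y) : Prop :=
  exists (P : C) (g : Hom X P) (h : Hom P Y), projective cf P /\ f = h \oc g.

Definition proj_ideal (X Y : C) : {pred Hom X Y} := fun f => `[< factors_proj f >].

Lemma projective_zob : projective cf zob.
Proof.
move=> B D g _ x; exists 0.
by rewrite compm0 -[x]compm1 zobP compm0.
Qed.

Lemma projective_biprod (P Q : C) :
  projective cf P -> projective cf Q -> projective cf (biprod P Q).
Proof.
move=> pP pQ B D g dg x.
have [y yE] := pP _ _ _ dg (x \oc inl_ P Q).
have [z zE] := pQ _ _ _ dg (x \oc inr_ P Q).
exists (y \oc prl P Q + z \oc prr P Q).
by rewrite compDr !compA yE zE -!compA -compDr inl_prl_inr_prr compm1.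
Qed.

Fact proj_ideal_zmod_closed X Y : zmod_closed (@proj_ideal X Y).
Proof.
split=> [|f f' /asboolP[P [g [h [pP ->]]]] /asboolP[Q [g' [h' [pQ ->]]]]].
  apply/asboolP; exists zob, 0, 0; split; first exact: projective_zob.
  by rewrite comp0m.
apply/asboolP; exists (biprod P Q), (inl_ P Q \oc g - inr_ P Q \oc g'),
  (h \oc prl P Q + h' \oc prr P Q); split; first exact: projective_biprod.
rewrite compDl !compDr !compmN.
rewrite -!(compA _ (prl P Q)) -!(compA _ (prr P Q)) !(compA (prl P Q)) !(compA (prr P Q)).
by rewrite prl_inl prr_inl prl_inr prr_inr !comp0m !comp1m !compm0 oppr0 addr0 add0r.
Qed.

HB.instance Definition _ X Y :=
  GRing.isZmodClosed.Build (Hom X Y) (@proj_ideal X Y) (proj_ideal_zmod_closed X Y).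

Definition stab_hom (X Y : C) : zmodType := Quotient.quot (@proj_ideal X Y).

Definition stab_pi (X Y : C) (f : Hom X Y) : stab_hom X Y :=
  \pi_(Quotient.quot (@proj_ideal X Y)) f.

Definition stab_comp (X Y Z : C) (g : stab_hom Y Z) (f : stab_hom X Y) : stab_hom X Z :=
  stab_pi (repr g \oc repr f).

Lemma stab_pi_eq X Y (f g : Hom X Y) :
  stab_pi f = stab_pi g <-> factors_proj (f - g).
Proof.
by rewrite -[factors_proj _]asboolE -[asbool _]/(f - g \in @proj_ideal X Y)
  Quotient.idealrBE; split=> /eqP.
Qed.

Lemma stab_pi_repr X Y (f : stab_hom X Y) : stab_pi (repr f) = f.
Proof. exact: reprK. Qed.

Lemma stab_piD X Y (f g : Hom X Y) : stab_pi (f + g) = stab_pi f + stab_pi g.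
Proof. exact: (raddfD \pi_(Quotient.quot (@proj_ideal X Y))). Qed.

Lemma stab_pi0 X Y : stab_pi (0 : Hom X Y) = 0.
Proof. exact: (raddf0 \pi_(Quotient.quot (@proj_ideal X Y))). Qed.

Lemma stab_pi_comp X Y Z (g : Hom Y Z) (f : Hom X Y) :
  stab_comp (stab_pi g) (stab_pi f) = stab_pi (g \oc f).
Proof.
have /stab_pi_eq[P [u [v [pP e]]]] := stab_pi_repr (stab_pi g).
have /stab_pi_eq[Q [u' [v' [pQ e']]]] := stab_pi_repr (stab_pi f).
rewrite /stab_comp; set g1 := repr _ in e *; set f1 := repr _ in e' *.
transitivity (stab_pi (g \oc f1)); apply/stab_pi_eq.
  exists P, (u \oc f1), v; split=> //.
  by rewrite -compNm -compDl e compA.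
exists Q, u', (g \oc v'); split=> //.
by rewrite -compmN -compDr e' compA.
Qed.

(* The stable category: same objects, Hom modulo the maps factoring through a
   projective object. *)
Definition stabCat : addCat.
Proof.
refine (@AddCat C stab_hom (fun X => stab_pi (idm X)) stab_comp _ _ _ _ _
  zob _ (@biprod C) (fun X Y => stab_pi (inl_ X Y)) (fun X Y => stab_pi (inr_ X Y))
  (fun X Y => stab_pi (prl X Y)) (fun X Y => stab_pi (prr X Y)) _ _ _).
- move=> X Y Z W h g f.
  by rewrite -(stab_pi_repr h) -(stab_pi_repr g) -(stab_pi_repr f) !stab_pi_comp compA.
- by move=> X Y f; rewrite -(stab_pi_repr f) stab_pi_comp comp1m.
- by move=> X Y f; rewrite -(stab_pi_repr f) stab_pi_comp compm1.
- move=> X Y Z g g' f; rewrite -(stab_pi_repr g) -(stab_pi_repr g') -(stab_pi_repr f).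
  by rewrite -stab_piD !stab_pi_comp -stab_piD compDl.
- move=> X Y Z g f f'; rewrite -(stab_pi_repr g) -(stab_pi_repr f) -(stab_pi_repr f').
  by rewrite -stab_piD !stab_pi_comp -stab_piD compDr.
- by rewrite zobP stab_pi0.
- by move=> X Y; rewrite stab_pi_comp prl_inl.
- by move=> X Y; rewrite stab_pi_comp prr_inr.
- by move=> X Y; rewrite !stab_pi_comp -stab_piD inl_prl_inr_prr.
Defined.

End StableCategory.

(* The data of a triangulated category: shift functor and distinguished
   triangles X -> Y -> Z -> shift X. *)
Record triData := TriData {
  tri_cat :> addCat;
  shift : tri_cat -> tri_cat;
  shiftm : forall X Y : tri_cat, Hom X Y -> Hom (shift X) (shift Y);
  distinguished : forall X Y Z : tri_cat,
    Hom X Y -> Hom Y Z -> Hom Z (shift X) -> Prop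
}.

Section StableTriangles.
Variables (C : addCat) (cf : seqClass C).
Notation S := (stabCat cf).

Record hull (X : C) := Hull {
  hull_ob : C;
  hull_susp : C;
  hull_in : Hom X hull_ob;
  hull_pr : Hom hull_ob hull_susp
}.

Definition is_hull (X : C) (h : hull X) : Prop :=
  injective_ob cf (hull_ob h) /\ cf (hull_in h) (hull_pr h).

(* A chosen conflation X -> I(X) -> Sigma X with I(X) injective; the fallback
   value is never reached when there are enough injectives. *)
Definition the_hull (X : C) : hull X :=
  if pselect (exists h : hull X, is_hull h) is left ex then projT1 (cid ex)
  else Hull (idm X) (0 : Hom X zob).

Definition susp (X : S) : S := hull_susp (the_hull X).

(* [g : Sigma X -> Sigma Y] is induced by [f : X -> Y] when some
   [h : I(X) -> I(Y)] makes (f, h, g) a morphism of the chosen conflations;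
   the stable class of such a [g] depends only on that of [f]. *)
Definition induces (X Y : C) (f : Hom X Y)
    (g : Hom (hull_susp (the_hull X)) (hull_susp (the_hull Y))) : Prop :=
  exists h : Hom (hull_ob (the_hull X)) (hull_ob (the_hull Y)),
    h \oc hull_in (the_hull X) = hull_in (the_hull Y) \oc f /\
    g \oc hull_pr (the_hull X) = hull_pr (the_hull Y) \oc h.

Definition suspm (X Y : S) (q : @Hom S X Y) : @Hom S (susp X) (susp Y) :=
  xget (0 : @Hom S (susp X) (susp Y))
    [set r | exists f g, [/\ induces f g, stab_pi cf f = q & stab_pi cf g = r]]%classic.

(* The standard triangle of [u : X -> Y]: Z is the pushout of X -> I(X) along u,
   and w : Z -> Sigma X is induced by I(X) -> Sigma X and 0 : Y -> Sigma X. *)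
Definition standard_triangle (X Y Z : C) (u : Hom X Y) (v : Hom Y Z)
    (w : Hom Z (hull_susp (the_hull X))) : Prop :=
  exists j : Hom (hull_ob (the_hull X)) Z,
    [/\ is_pushout (hull_in (the_hull X)) u j v,
        w \oc j = hull_pr (the_hull X) & w \oc v = 0].

Definition stab_distinguished (X Y Z : S) (u : @Hom S X Y) (v : @Hom S Y Z)
    (w : @Hom S Z (susp X)) : Prop :=
  exists (X' Y' Z' : C) (u' : Hom X' Y') (v' : Hom Y' Z')
      (w' : Hom Z' (hull_susp (the_hull X')))
      (a : @Hom S X X') (b : @Hom S Y Y') (c : @Hom S Z Z'),
    [/\ standard_triangle u' v' w', [/\ is_iso a, is_iso b & is_iso c],
        b \oc u = (stab_pi cf u' : @Hom S X' Y') \oc a,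
        c \oc v = (stab_pi cf v' : @Hom S Y' Z') \oc b &
        suspm a \oc w = (stab_pi cf w' : @Hom S Z' (susp X')) \oc c].

Definition stabTri : triData := TriData suspm stab_distinguished.

End StableTriangles.

(* A full subcategory is given by its class of objects. *)
Definition subcat (T : triData) := T -> Prop.

Section Recollements.
Variable T : triData.

Record triangulated_subcat (U : subcat T) : Prop := TriangulatedSubcat {
  tsub_zero : U zob;
  tsub_biprod : forall X Y : T, U X -> U Y -> U (biprod X Y);
  tsub_iso : forall X Y : T, isomorphic X Y -> U X -> U Y;
  tsub_shift : forall X : T, U X -> U (shift X);
  tsub_unshift : forall X : T, U (shift X) -> U X;
  tsub_cone : forall (X Y Z : T) (u : Hom X Y) (v : Hom Y Z) (w : Hom Z (shift X)),
    distinguished u v w -> U X -> U Y -> U Z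
}.

Definition semiorthogonal_decomposition (U V : subcat T) : Prop :=
  [/\ triangulated_subcat U, triangulated_subcat V,
      forall X Y : T, U X -> V Y -> forall f : Hom X Y, f = 0 &
      forall X : T, exists (A B : T) (u : Hom A X) (v : Hom X B) (w : Hom B (shift A)),
        [/\ U A, V B & distinguished u v w]].

(* Positions of the list are read modulo n. *)
Definition ngon_of_recollements (n : nat) (L : seq (subcat T)) : Prop :=
  [/\ (2 <= n)%N, size L = n &
      forall i : nat, (i < n)%N ->
        semiorthogonal_decomposition
          (nth (fun=> False) L i) (nth (fun=> False) L (i.+1 %% n))].

End Recollements.

Section GammaDelta.
Variables (F : exactCat) (l : nat).

Definition stabMor : triData := stabTri (@chain_conf F l).

Definition Gamma (s t : nat) : subcat stabMor :=
  fun X : chain F l => forall k : 'I_l.+1, (k < s)%N || (t < k)%N ->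
    projective (@conf F) (X k).

Definition Delta (s t : nat) : subcat stabMor :=
  fun X => exists Y : chain F l, @isomorphic stabMor X Y /\
    forall k : 'I_l, (s <= k < t)%N -> is_idm (ch_map Y k).

End GammaDelta.

Arguments Gamma F l s t : clear implicits.
Arguments Delta F l s t : clear implicits.

(* Main.v *)
(** The list contains only three kinds of consecutive pairs: [(Gamma a b, Delta a (b+1))],
    [(Delta a b, Gamma (a+1) b)] and [(Gamma (a+1) l, Gamma 0 a)]. For each of them:
    - A ladder [X -> Y] between the two classes is null because it factors through an
      explicit termwise projective chain, built position by position.
    - The triangle of [X] is the standard triangle of a ladder [u : A -> X]. For
      [(Delta, Gamma)], [A] is [X] made constant on [[a, b]]; for [(Gamma, Gamma)], [A] is
      [X] with its terms up to [a] replaced by zero; in both cases the cone is projective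
      wherever [u] is invertible. For [(Gamma, Delta)], [A] pulls [X] back along a
      deflation from a projective onto [X^(b+1)], so that the squares of [u] over
      [[a, b+1]] are bicartesian, and then the arrows of the cone there are pushouts of
      inflations between projectives.
    Being triangulated reduces to two-out-of-three properties in termwise conflations: for
    [Gamma] that of projective objects, and for [Delta], described as the chains whose
    arrows in [[a, b]] have projective cokernels, that of such inflations (3x3 lemma). *)

From mathcomp Require Import all_boot ssralg.
From mathcomp Require Import boolp classical_sets.
Require Import Defs.

Set Implicit Arguments.
Unset Strict Implicit.
Unset Printing Implicit Defensive.

Import GRing.Theory.

(** * Additive categories *)

Section AdditiveCategories.
Local Open Scope ring_scope.
Variable C : addCat.
Implicit Types A B D T : C.

Lemma comp_pre A B D T (g : Hom B D) (f : Hom A B) (h : Hom A D) :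
  g \oc f = h -> forall x : Hom T A, g \oc (f \oc x) = h \oc x.
Proof. by move=> <- x; rewrite compA. Qed.

Lemma compBl A B D (g g' : Hom B D) (f : Hom A B) :
  (g - g') \oc f = g \oc f - g' \oc f.
Proof. by rewrite compDl compNm. Qed.

Lemma compBr A B D (g : Hom B D) (f f' : Hom A B) :
  g \oc (f - f') = g \oc f - g \oc f'.
Proof. by rewrite compDr compmN. Qed.

Lemma kernel_mono A B D (f : Hom A B) (g : Hom B D) T (x y : Hom T A) :
  is_kernel f g -> f \oc x = f \oc y -> x = y.
Proof.
move=> [gf0 univ] e; have [|h [_ uh]] := univ T (f \oc x).
  by rewrite compA gf0 comp0m.
by rewrite -(uh x) // -(uh y).
Qed.

Lemma kernel_lift A B D (f : Hom A B) (g : Hom B D) T (x : Hom T B) :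
  is_kernel f g -> g \oc x = 0 -> exists h : Hom T A, f \oc h = x.
Proof. by move=> [_ univ] /univ[h [e _]]; exists h. Qed.

Lemma cokernel_epi A B D (f : Hom A B) (g : Hom B D) T (x y : Hom D T) :
  is_cokernel f g -> x \oc g = y \oc g -> x = y.
Proof.
move=> [gf0 univ] e; have [|h [_ uh]] := univ T (x \oc g).
  by rewrite -compA gf0 compm0.
by rewrite -(uh x) // -(uh y).
Qed.

Lemma cokernel_lift A B D (f : Hom A B) (g : Hom B D) T (x : Hom B T) :
  is_cokernel f g -> x \oc f = 0 -> exists h : Hom D T, h \oc g = x.
Proof. by move=> [_ univ] /univ[h [e _]]; exists h. Qed.

Lemma cokernel_unique A B D D' (f : Hom A B) (g : Hom B D) (g' : Hom B D') :
  is_cokernel f g -> is_cokernel f g' ->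
  exists c : Hom D D', is_iso c /\ c \oc g = g'.
Proof.
move=> cg cg'; have [c ec] := cokernel_lift cg cg'.1.
have [c' ec'] := cokernel_lift cg' cg.1.
exists c; split=> //; exists c'; split.
  by apply: (cokernel_epi cg); rewrite -compA ec ec' comp1m.
by apply: (cokernel_epi cg'); rewrite -compA ec' ec comp1m.
Qed.

Lemma kernel_unique A A' B D (f : Hom A B) (f' : Hom A' B) (g : Hom B D) :
  is_kernel f g -> is_kernel f' g ->
  exists c : Hom A A', is_iso c /\ f' \oc c = f.
Proof.
move=> kf kf'; have [c ec] := kernel_lift kf' kf.1.
have [c' ec'] := kernel_lift kf kf'.1.
exists c; split=> //; exists c'; split.
  by apply: (kernel_mono kf); rewrite compA ec' ec compm1.
by apply: (kernel_mono kf'); rewrite compA ec ec' compm1.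
Qed.

Lemma iso_id A : is_iso (idm A).
Proof. by exists (idm A); rewrite comp1m. Qed.

Lemma iso_comp A B D (g : Hom B D) (f : Hom A B) :
  is_iso f -> is_iso g -> is_iso (g \oc f).
Proof.
move=> [f' [f'f ff']] [g' [g'g gg']]; exists (f' \oc g'); split.
  by rewrite -!compA (comp_pre g'g) comp1m.
by rewrite -!compA (comp_pre ff') comp1m.
Qed.

Lemma isomorphic_sym A B : isomorphic A B -> isomorphic B A.
Proof. by move=> [f [g [gf fg]]]; exists g, f. Qed.

Lemma isomorphic_trans A B D : isomorphic A B -> isomorphic B D -> isomorphic A D.
Proof. by move=> [f If] [g Ig]; exists (g \oc f); apply: iso_comp. Qed.

Lemma pushout_sym A B A' D (f : Hom A B) (a : Hom A A')
    (b : Hom B D) (f' : Hom A' D) :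
  is_pushout f a b f' -> is_pushout a f f' b.
Proof.
move=> [sq univ]; split=> // T x y e.
have [h [[hb hf] uh]] := univ T y x (esym e).
by exists h; split=> // k [kf kb]; apply: uh.
Qed.

Lemma pushout_ext A B A' D (f : Hom A B) (a : Hom A A')
    (b : Hom B D) (f' : Hom A' D) T (x y : Hom D T) :
  is_pushout f a b f' -> x \oc b = y \oc b -> x \oc f' = y \oc f' -> x = y.
Proof.
move=> [sq univ] eb ef; have [|h [_ uh]] := univ T (x \oc b) (x \oc f').
  by rewrite -!compA sq.
by rewrite -(uh x) // -(uh y).
Qed.

Lemma pushout_desc A B A' D (f : Hom A B) (a : Hom A A')
    (b : Hom B D) (f' : Hom A' D) T (x : Hom B T) (y : Hom A' T) :
  is_pushout f a b f' -> x \oc f = y \oc a ->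
  exists h : Hom D T, h \oc b = x /\ h \oc f' = y.
Proof. by move=> [_ univ] /univ[h [e _]]; exists h. Qed.

Lemma pushoutI A B A' D (f : Hom A B) (a : Hom A A') (b : Hom B D) (f' : Hom A' D) :
  b \oc f = f' \oc a ->
  (forall T (x y : Hom D T), x \oc b = y \oc b -> x \oc f' = y \oc f' -> x = y) ->
  (forall T (x : Hom B T) (y : Hom A' T), x \oc f = y \oc a ->
     exists h : Hom D T, h \oc b = x /\ h \oc f' = y) ->
  is_pushout f a b f'.
Proof.
move=> sq ext desc; split=> // T x y /desc[h [hb hf]]; exists h; split=> // k [kb kf].
by apply: ext; rewrite ?hb ?hf.
Qed.

Lemma pushout_unique A B A' D D' (f : Hom A B) (a : Hom A A')
    (b : Hom B D) (f' : Hom A' D) (b1 : Hom B D') (f1 : Hom A' D') :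
  is_pushout f a b f' -> is_pushout f a b1 f1 ->
  exists c : Hom D D', [/\ is_iso c, c \oc b = b1 & c \oc f' = f1].
Proof.
move=> p p1; have [c [cb cf]] := pushout_desc p p1.1.
have [c' [cb' cf']] := pushout_desc p1 p.1.
exists c; split=> //; exists c'; split.
  by apply: (pushout_ext p); rewrite -compA ?cb ?cf ?cb' ?cf' comp1m.
by apply: (pushout_ext p1); rewrite -compA ?cb' ?cf' ?cb ?cf comp1m.
Qed.

Lemma pushout_iso A B A' D D' (f : Hom A B) (a : Hom A A')
    (b : Hom B D) (f' : Hom A' D) (c : Hom D D') :
  is_iso c -> is_pushout f a b f' -> is_pushout f a (c \oc b) (c \oc f').
Proof.
move=> [c' [c'c cc']] p; apply: pushoutI => [|T x y|T x y e].
- by rewrite -!compA p.1.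
- rewrite !compA => eb ef.
  by rewrite -[x]compm1 -[y]compm1 -cc' !compA (pushout_ext p eb ef).
- have [h [hb hf]] := pushout_desc p e; exists (h \oc c').
  by rewrite -!compA (comp_pre c'c) (comp_pre c'c) !comp1m.
Qed.

Lemma pushout_paste A B D A' B' D' (a : Hom A B) (b : Hom B D)
    (f : Hom A A') (g : Hom B B') (h : Hom D D') (a' : Hom A' B') (b' : Hom B' D') :
  is_pushout a f g a' -> is_pushout b g h b' -> is_pushout (b \oc a) f h (b' \oc a').
Proof.
move=> p q; apply: pushoutI => [|T x y|T x y e].
- by rewrite compA q.1 -!compA p.1.
- move=> eh ea; apply: (pushout_ext q) => //.
  apply: (pushout_ext p); last by rewrite -!compA.
  by rewrite -!compA -q.1 !compA eh.
- have [|k [kg ka]] := @pushout_desc _ _ _ _ _ _ _ _ T (x \oc b) y p.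
    by rewrite -compA e.
  have [m [mh mb]] := pushout_desc q (esym kg).
  by exists m; split=> //; rewrite compA mb.
Qed.

Lemma pushout_cancel A B D A' B' D' (a : Hom A B) (b : Hom B D)
    (f : Hom A A') (g : Hom B B') (h : Hom D D') (a' : Hom A' B') (b' : Hom B' D') :
  is_pushout a f g a' -> h \oc b = b' \oc g ->
  is_pushout (b \oc a) f h (b' \oc a') -> is_pushout b g h b'.
Proof.
move=> p sq q; apply: pushoutI => [//|T x y eh eb|T x y e].
  by apply: (pushout_ext q) => //; rewrite !compA eb.
have [|m [mh ma]] := @pushout_desc _ _ _ _ _ _ _ _ T x (y \oc a') q.
  by rewrite compA e -!compA p.1.
exists m; split=> //; apply: (pushout_ext p); last by rewrite -compA ma.
by rewrite -compA -sq compA mh e.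
Qed.

(* The cube whose front and back faces are the first two squares and whose edges from
   front to back are [alpha], [xi], [iota], [zeta]. *)
Lemma pushout_cube A X I Z A' X' I' Z' (u : Hom A X) (i : Hom A I)
    (v : Hom X Z) (j : Hom I Z) (u' : Hom A' X') (i' : Hom A' I')
    (v' : Hom X' Z') (j' : Hom I' Z') (alpha : Hom A A') (xi : Hom X X')
    (iota : Hom I I') (zeta : Hom Z Z') :
  is_pushout i u j v -> is_pushout i' u' j' v' -> is_pushout alpha u u' xi ->
  iota \oc i = i' \oc alpha ->
  zeta \oc j = j' \oc iota -> zeta \oc v = v' \oc xi ->
  is_pushout iota j j' zeta.
Proof.
move=> pZ pZ' pX ei ej ev; apply: (pushout_cancel pZ) => //.
by rewrite ei ev; apply: (pushout_paste pX pZ').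
Qed.

Lemma copair_inl A B T (x : Hom A T) (y : Hom B T) :
  (x \oc prl A B + y \oc prr A B) \oc inl_ A B = x.
Proof. by rewrite compDl -!compA prl_inl prr_inl compm1 compm0 addr0. Qed.

Lemma copair_inr A B T (x : Hom A T) (y : Hom B T) :
  (x \oc prl A B + y \oc prr A B) \oc inr_ A B = y.
Proof. by rewrite compDl -!compA prl_inr prr_inr compm1 compm0 add0r. Qed.

Lemma pair_prl A B T (x : Hom T A) (y : Hom T B) :
  prl A B \oc (inl_ A B \oc x + inr_ A B \oc y) = x.
Proof. by rewrite compDr !compA prl_inl prl_inr comp1m comp0m addr0. Qed.

Lemma pair_prr A B T (x : Hom T A) (y : Hom T B) :
  prr A B \oc (inl_ A B \oc x + inr_ A B \oc y) = y.
Proof. by rewrite compDr !compA prr_inl prr_inr comp1m comp0m add0r. Qed.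

Lemma copair_pair A B T S (x : Hom A T) (y : Hom B T) (x' : Hom S A) (y' : Hom S B) :
  (x \oc prl A B + y \oc prr A B) \oc (inl_ A B \oc x' + inr_ A B \oc y')
  = x \oc x' + y \oc y'.
Proof. by rewrite compDl -!compA pair_prl pair_prr. Qed.

Lemma pushout_biprod_cokernel A B A' D (f : Hom A B) (a : Hom A A')
    (b : Hom B D) (f' : Hom A' D) :
  is_pushout f a b f' ->
  is_cokernel (inl_ A' B \oc a + inr_ A' B \oc f) (f' \oc prl A' B + (- b) \oc prr A' B).
Proof.
move=> p; split; first by rewrite copair_pair compNm p.1 subrr.
move=> T x; rewrite compDr !compA => e.
have [|h [hb hf]] := @pushout_desc _ _ _ _ _ _ _ _ T (- (x \oc inr_ A' B)) (x \oc inl_ A' B) p.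
  by rewrite compNm; apply/esym/eqP; rewrite -addr_eq0 e.
exists h; split.
  apply: biprod_ext; rewrite -compA ?copair_inl ?copair_inr //.
  by rewrite compmN hb opprK.
move=> k ek; apply: (pushout_ext p); rewrite ?hb ?hf -ek -!compA ?copair_inl ?copair_inr //.
by rewrite compmN opprK.
Qed.

Lemma zero_hom_from (A : C) (f : Hom zob A) : f = 0.
Proof. by rewrite -[f]compm1 zobP compm0. Qed.

End AdditiveCategories.

(** * Exact categories *)

Section ExactCategories.
Local Open Scope ring_scope.
Variable E : exactCat.
Implicit Types A B D T : E.
Local Notation cf f g := (conf _ _ _ f g).
Local Notation infl := (inflation (@conf E)).
Local Notation defl := (deflation (@conf E)).

Lemma conf0 A B D (f : Hom A B) (g : Hom B D) : cf f g -> g \oc f = 0.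
Proof. by move=> /(conf_ker (exactP E))[]. Qed.

Lemma conf_mono A B D (f : Hom A B) (g : Hom B D) T (x y : Hom T A) :
  cf f g -> f \oc x = f \oc y -> x = y.
Proof. by move=> /(conf_ker (exactP E)); apply: kernel_mono. Qed.

Lemma conf_epi A B D (f : Hom A B) (g : Hom B D) T (x y : Hom D T) :
  cf f g -> x \oc g = y \oc g -> x = y.
Proof. by move=> /(conf_coker (exactP E)); apply: cokernel_epi. Qed.

Lemma conf_lift A B D (f : Hom A B) (g : Hom B D) T (x : Hom T B) :
  cf f g -> g \oc x = 0 -> exists h : Hom T A, f \oc h = x.
Proof. by move=> /(conf_ker (exactP E)); apply: kernel_lift. Qed.

Lemma conf_desc A B D (f : Hom A B) (g : Hom B D) T (x : Hom B T) :
  cf f g -> x \oc f = 0 -> exists h : Hom D T, h \oc g = x.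
Proof. by move=> /(conf_coker (exactP E)); apply: cokernel_lift. Qed.

Lemma conf_cokernel A B D (f : Hom A B) (g : Hom B D) :
  infl f -> is_cokernel f g -> cf f g.
Proof.
move=> [D0 [g0 c0]] cg.
have [c [Ic ec]] := cokernel_unique (conf_coker (exactP E) c0) cg.
apply: (conf_iso (exactP E) (iso_id _) (iso_id _) Ic _ _ c0).
  by rewrite comp1m compm1.
by rewrite compm1.
Qed.

Lemma conf_kernel A B D (f : Hom A B) (g : Hom B D) :
  defl g -> is_kernel f g -> cf f g.
Proof.
move=> [A0 [f0 c0]] kf.
have [c [Ic ec]] := kernel_unique (conf_ker (exactP E) c0) kf.
apply: (conf_iso (exactP E) Ic (iso_id _) (iso_id _) _ _ c0).
  by rewrite comp1m.
by rewrite comp1m compm1.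
Qed.

Lemma infl_iso A B (f : Hom A B) : is_iso f -> infl f.
Proof.
move=> If; have [g [gf fg]] := If; have [D [p cp]] := infl_id (exactP E) A.
exists D, (p \oc g).
apply: (conf_iso (exactP E) (iso_id _) If (iso_id _) _ _ cp).
  by [].
by rewrite comp1m -compA gf compm1.
Qed.

Lemma conf_0id A : cf (0 : Hom zob A) (idm A).
Proof.
have [K [k ck]] := defl_id (exactP E) A.
have k0 : k = 0 by rewrite -(conf0 ck) comp1m.
have K0 : idm K = 0 by apply: (conf_mono ck); rewrite k0 !comp0m.
have I0 : is_iso (0 : Hom K zob) by exists 0; rewrite !comp0m K0 zobP.
apply: (conf_iso (exactP E) I0 (iso_id _) (iso_id _) _ _ ck) => //.
by rewrite k0 compm0 comp0m.
Qed.

Lemma conf_id0 A : cf (idm A) (0 : Hom A zob).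
Proof.
apply: conf_cokernel; first exact: infl_id (exactP E) A.
split=> [|T x]; first by rewrite comp0m.
rewrite compm1 => ->; exists 0; split=> [|h _]; first by rewrite comp0m.
by rewrite (zero_hom_from h).
Qed.

(** Inflations are stable under pushout, so only the cokernel of [f'] is in question; a map out of
    [D] that kills [f'] is determined by its restriction along [b], hence by a map out of [G]. *)
Lemma conf_pushout A B A' D G (f : Hom A B) (a : Hom A A')
    (b : Hom B D) (f' : Hom A' D) (g : Hom B G) (q : Hom D G) :
  is_pushout f a b f' -> cf f g -> q \oc b = g -> q \oc f' = 0 -> cf f' q.
Proof.
move=> p cg qb qf; apply: conf_cokernel; first by apply: (infl_pushout p); exists G, g.
split=> // T x xf.
have [|h hg] := @conf_desc _ _ _ _ _ _ (x \oc b) cg.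
  by rewrite -compA p.1 compA xf comp0m.
exists h; split.
  by apply: (pushout_ext p); rewrite -compA ?qb ?qf ?compm0.
by move=> k ek; apply: (conf_epi cg); rewrite hg -ek -qb compA.
Qed.

Lemma conf_pushout_ex A B A' D G (f : Hom A B) (a : Hom A A')
    (b : Hom B D) (f' : Hom A' D) (g : Hom B G) :
  is_pushout f a b f' -> cf f g ->
  exists q : Hom D G, [/\ q \oc b = g, q \oc f' = 0 & cf f' q].
Proof.
move=> p cg; have [|q [qb qf]] := @pushout_desc _ _ _ _ _ _ _ _ _ _ g 0 p.
  by rewrite (conf0 cg) comp0m.
by exists q; split=> //; apply: (conf_pushout p cg).
Qed.

Lemma conf_pullback X X' X'' A' P (xi : Hom X X') (e : Hom X' X'') (q : Hom A' X')
    (b : Hom P A') (g : Hom P X) :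
  cf xi e -> defl q -> is_pullback q xi b g -> cf b (e \oc q).
Proof.
move=> ce dq [sq univ]; apply: conf_kernel.
  by apply: (defl_comp (exactP E)) => //; exists X, xi.
split=> [|T x]; first by rewrite -compA sq compA (conf0 ce) comp0m.
rewrite -compA => /(conf_lift ce)[y ey].
have [h [[hb hg] uh]] := univ _ _ _ (esym ey).
exists h; split=> // k ek; apply: uh; split=> //.
by apply: (conf_mono ce); rewrite ey -ek !compA sq.
Qed.

Lemma pullback_pushout X X' A' P (xi : Hom X X') (q : Hom A' X')
    (b : Hom P A') (g : Hom P X) :
  defl q -> defl g -> is_pullback q xi b g -> is_pushout b g q xi.
Proof.
move=> [K [k ck]] [K' [k' ck']] [sq univ].
apply: pushoutI => [//|T x y eq _|T x y e]; first exact: (conf_epi ck).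
have [|m [[mb mg] _]] := univ _ k 0; first by rewrite (conf0 ck) compm0.
have [|h hq] := @conf_desc _ _ _ _ _ _ x ck.
  by rewrite -mb compA e -compA mg compm0.
by exists h; split=> //; apply: (conf_epi ck'); rewrite -e -compA -sq compA hq.
Qed.

(** The map [f] is monic by a chase. Pulling [p] back along [p'] covers [Q] by a deflation [r2] that
    factors through [f], and monicity lets this factorization descend to an inverse of [f]. *)
Lemma short_five A P Q D (i : Hom A P) (p : Hom P D) (i' : Hom A Q) (p' : Hom Q D)
    (f : Hom P Q) :
  cf i p -> is_kernel i' p' -> f \oc i = i' -> p' \oc f = p -> is_iso f.
Proof.
move=> ci ki fi pf.
have mono_f T (x : Hom T P) : f \oc x = 0 -> x = 0.
  move=> fx0; have [|y ey] := @conf_lift _ _ _ _ _ _ x ci.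
    by rewrite -pf -compA fx0 compm0.
  have -> : x = i \oc y by [].
  suff -> : y = 0 by rewrite compm0.
  by apply: (kernel_mono ki); rewrite compm0 -fi -compA ey.
have dp : defl p by exists A, i.
have [R [r1 [r2 [[sq _] [N [n cn]]]]]] := defl_pull (exactP E) p' dp.
have [|y ey] := @kernel_lift _ _ _ _ _ _ _ (f \oc r1 - r2) ki.
  by rewrite compBr compA pf sq subrr.
have er2 : r2 = f \oc (r1 - i \oc y).
  by rewrite compBr compA fi ey opprB addrC subrK.
have [|h hr] := @conf_desc _ _ _ _ _ _ (r1 - i \oc y) cn.
  by apply: mono_f; rewrite compA -er2 (conf0 cn).
have fh : f \oc h = idm Q.
  by apply: (conf_epi cn); rewrite -compA hr -er2 comp1m.
exists h; split=> //; apply/eqP; rewrite -subr_eq0; apply/eqP; apply: mono_f.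
by rewrite compBr compA fh comp1m compm1 subrr.
Qed.

(* [P] is the pushout of the left-hand square; it is also the pullback of [g'] along
   [d], i.e. the kernel of the deflation [d' g']. *)
Lemma conf_latching A B D A' B' D' D'' P (f : Hom A B) (g : Hom B D)
    (f' : Hom A' B') (g' : Hom B' D') (a : Hom A A') (b : Hom B B') (d : Hom D D')
    (d' : Hom D' D'') (b1 : Hom B P) (a1 : Hom A' P) (u : Hom P B') :
  cf f g -> cf f' g' -> cf d d' -> d \oc g = g' \oc b ->
  is_pushout f a b1 a1 -> u \oc b1 = b -> u \oc a1 = f' -> cf u (d' \oc g').
Proof.
move=> cg cg' cd sq p ub ua.
have [q [qb qa cq]] := conf_pushout_ex p cg.
have sqP : g' \oc u = d \oc q.
  apply: (pushout_ext p); rewrite -!compA ?ub ?ua ?qb ?qa //.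
  by rewrite (conf0 cg') compm0.
have dg' : defl g' by exists A', f'.
(* [Q] is the pullback that [P] is to be identified with. The comparison map [m] is invertible by
   [short_five], as both objects extend [D] by [A']. *)
have [Q [v [w [pb [N [n cn]]]]]] := defl_pull (exactP E) d dg'.
have cv := conf_pullback cd dg' pb; have [sqQ univ] := pb.
have [m [[vm wm] _]] := univ _ u q sqP.
have ki : is_kernel (m \oc a1) w.
  split=> [|T x wx]; first by rewrite compA wm.
  have [|y ey] := @conf_lift _ _ _ _ _ _ (v \oc x) cg'.
    by rewrite compA sqQ -compA wx compm0.
  exists y; split; first by apply: (conf_mono cv); rewrite !compA vm ua.
  by move=> z ez; apply: (conf_mono cg'); rewrite ey -ez -ua -vm !compA.
have Im : is_iso m by apply: (short_five cq ki).
have [m' [m'm mm']] := Im.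
apply: (conf_iso (exactP E) (a := m') (b := idm B') (d := idm D'') (f := v)
          (g := d' \oc g')); rewrite ?comp1m ?compm1 //.
- by exists m.
- exact: iso_id.
- exact: iso_id.
- by rewrite -vm -compA mm' compm1.
Qed.

(** The third isomorphism theorem: the pushout [X] of [p] along [g] is the quotient of [G] by [A],
    and it extends the quotient of [G] by [B] by that of [B] by [A]. *)
Lemma noether A B D G K (f : Hom A B) (p : Hom B D) (g : Hom B G) (q : Hom G K) :
  cf f p -> cf g q -> exists (X : E) (n : Hom G X) (c : Hom D X) (r : Hom X K),
  [/\ cf (g \oc f) n, cf c r, c \oc p = n \oc g & r \oc n = q].
Proof.
move=> cp cq; have ig : infl g by exists K, q.
have [X [n [c [po _]]]] := infl_push (exactP E) p ig.
have [r [rn _ cr]] := conf_pushout_ex po cq.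
exists X, n, c, r; split=> //; last by rewrite po.1.
apply: conf_cokernel; first by apply: (infl_comp (exactP E)) => //; exists D, p.
split=> [|T x]; first by rewrite compA po.1 -compA (conf0 cp) compm0.
rewrite compA => /(conf_desc cp)[y ey].
have [h [hn hc]] := pushout_desc po (esym ey).
exists h; split=> // k ek; apply: (pushout_ext po); rewrite ?hn ?hc //.
by apply: (conf_epi cp); rewrite -compA -po.1 compA ek ey.
Qed.

Section MapOfConflations.
Variables (A B D A' B' D' A'' B'' D'' : E).
Variables (f : Hom A B) (g : Hom B D) (f' : Hom A' B') (g' : Hom B' D').
Variables (a : Hom A A') (b : Hom B B') (d : Hom D D').
Hypotheses (cg : cf f g) (cg' : cf f' g') (sqf : b \oc f = f' \oc a)
  (sqg : d \oc g = g' \oc b).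

(** Factor [b] through the pushout [P] of [f] and [a]. The map [B -> P] is a pushout of [a], and
    [P -> B'] is an inflation with the cokernel of [d] by [conf_latching]. *)
Lemma infl_middle : infl a -> infl d -> infl b.
Proof.
move=> ia [X [d' cd]]; have if_ : infl f by exists D, g.
have [P [b1 [a1 [po _]]]] := infl_push (exactP E) a if_.
have [u [ub ua]] := pushout_desc po sqf.
rewrite -ub; apply: (infl_comp (exactP E)).
  exact: infl_pushout (pushout_sym po) ia.
by exists X, (d' \oc g'); apply: (conf_latching cg cg' cd sqg po).
Qed.

(** In the factorization of [b] through the pushout [P], the two steps have cokernels [A''] and
    [D'']; [noether] makes the cokernel of the composite an extension of the latter by the
    former. *)
Lemma three_by_three (a' : Hom A' A'') (b' : Hom B' B'') (d' : Hom D' D'') :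
  cf a a' -> cf b b' -> cf d d' ->
  exists (f'' : Hom A'' B'') (g'' : Hom B'' D''), cf f'' g''.
Proof.
move=> ca cb cd; have if_ : infl f by exists D, g.
have [P [b1 [a1 [po _]]]] := infl_push (exactP E) a if_.
have [u [ub ua]] := pushout_desc po sqf.
have cu := conf_latching cg cg' cd sqg po ub ua.
have [q1 [_ _ cq1]] := conf_pushout_ex (pushout_sym po) ca.
have [X [n [c [r [cn cr _ _]]]]] := noether cq1 cu.
move: cn; rewrite ub => cn.
have [x [Ix ex]] := cokernel_unique (conf_coker (exactP E) cn) (conf_coker (exactP E) cb).
have [x' [x'x xx']] := Ix.
exists (x \oc c), (r \oc x').
apply: (conf_iso (exactP E) (iso_id _) Ix (iso_id _) _ _ cr).
  by rewrite compm1.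
by rewrite comp1m -compA x'x compm1.
Qed.

End MapOfConflations.

Lemma infl_inl A B : infl (inl_ A B).
Proof.
apply: (@infl_pushout _ zob B A _ 0 0 (inr_ A B)); last by exists B, (idm B); exact: conf_0id.
apply: pushoutI => [|T x y|T x y _]; first by rewrite !compm0.
  by move=> er el; apply: biprod_ext.
by exists (y \oc prl A B + x \oc prr A B); rewrite copair_inl copair_inr.
Qed.

(** Up to the shear automorphism [idm _ + n], where [n \oc n = 0], the pair is the inclusion of a
    summand followed by [bisum f (idm B)]. *)
Lemma infl_pair T A B (f : Hom T A) (x : Hom T B) :
  infl f -> infl (inl_ A B \oc f + inr_ A B \oc x).
Proof.
move=> inf; pose n := inr_ T B \oc x \oc prl T B.
have nn : n \oc n = 0.
  by rewrite /n -!compA (comp_pre (prl_inr T B)) comp0m !compm0.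
have Iphi : is_iso (idm _ + n).
  exists (idm _ - n); split; first by rewrite compDr compm1 compBl comp1m nn subr0 subrK.
  by rewrite compBr compm1 compDl comp1m nn addr0 addrK.
have -> : inl_ A B \oc f + inr_ A B \oc x
          = bisum f (idm B) \oc (idm _ + n) \oc inl_ T B.
  rewrite -compA compDl comp1m /n -!compA prl_inl compm1 compDr bisum_inl compA.
  by rewrite bisum_inr compm1.
apply: (infl_comp (exactP E)); first exact: infl_inl.
apply: (infl_comp (exactP E)); first exact: infl_iso.
by apply: infl_bisum => //; apply: infl_id (exactP E) _.
Qed.

Lemma conf_pushout_biprod A B A' D (f : Hom A B) (a : Hom A A')
    (b : Hom B D) (f' : Hom A' D) :
  infl a -> is_pushout f a b f' ->
  cf (inl_ A' B \oc a + inr_ A' B \oc f) (f' \oc prl A' B + (- b) \oc prr A' B).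
Proof.
by move=> ia po; apply: conf_cokernel; [exact: infl_pair | exact: pushout_biprod_cokernel].
Qed.

Lemma conf_retraction A B D (f : Hom A B) (g : Hom B D) (r : Hom B A) :
  cf f g -> r \oc f = idm A ->
  exists s : Hom D B, g \oc s = idm D /\ f \oc r + s \oc g = idm B.
Proof.
move=> cg rf; have [|s es] := @conf_desc _ _ _ _ _ _ (idm B - f \oc r) cg.
  by rewrite compBl comp1m -compA rf compm1 subrr.
exists s; split; last by rewrite es addrC subrK.
apply: (conf_epi cg); rewrite -compA es compBr compm1 compA (conf0 cg) comp0m subr0.
by rewrite comp1m.
Qed.

Lemma conf_section A B D (f : Hom A B) (g : Hom B D) (s : Hom D B) :
  cf f g -> g \oc s = idm D ->
  exists r : Hom B A, r \oc f = idm A /\ f \oc r + s \oc g = idm B.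
Proof.
move=> cg gs; have [|r er] := @conf_lift _ _ _ _ _ _ (idm B - s \oc g) cg.
  by rewrite compBr compm1 compA gs comp1m subrr.
exists r; split; last by rewrite er subrK.
apply: (conf_mono cg); rewrite compA er compBl comp1m -compA (conf0 cg) compm0 subr0.
by rewrite compm1.
Qed.

End ExactCategories.

(** * Frobenius categories *)

Section NullMaps.
Local Open Scope ring_scope.
Variables (C : addCat) (K : seqClass C).

Lemma projective_retract (P A : C) (s : Hom A P) (r : Hom P A) :
  r \oc s = idm A -> projective K P -> projective K A.
Proof.
move=> rs pP B D g dg x; have [y ey] := pP _ _ _ dg (x \oc r).
by exists (y \oc s); rewrite compA ey -compA rs compm1.
Qed.

Lemma factors_projD (A B : C) (x y : Hom A B) :
  factors_proj K x -> factors_proj K y -> factors_proj K (x + y).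
Proof.
move=> /asboolP fx /asboolP fy; apply/asboolP.
by apply: (@rpredD _ (proj_ideal K (X := A) (Y := B))).
Qed.

Lemma factors_projN (A B : C) (x : Hom A B) : factors_proj K x -> factors_proj K (- x).
Proof. by move=> [P [g [h [pP ->]]]]; exists P, g, (- h); rewrite compNm. Qed.

Lemma factors_projB (A B : C) (x y : Hom A B) :
  factors_proj K x -> factors_proj K y -> factors_proj K (x - y).
Proof. by move=> fx /factors_projN; apply: factors_projD. Qed.

Lemma factors_proj_compl (A B D : C) (x : Hom A B) (y : Hom B D) :
  factors_proj K x -> factors_proj K (y \oc x).
Proof. by move=> [P [g [h [pP ->]]]]; exists P, g, (y \oc h); rewrite compA. Qed.

Lemma factors_proj_compr (A B D : C) (x : Hom B D) (y : Hom A B) :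
  factors_proj K x -> factors_proj K (x \oc y).
Proof. by move=> [P [g [h [pP ->]]]]; exists P, (g \oc y), h; rewrite compA. Qed.

Lemma factors_proj_through (A P B : C) (x : Hom P B) (y : Hom A P) :
  projective K P -> factors_proj K (x \oc y).
Proof. by move=> pP; exists P, y, x. Qed.

Lemma projective_null (A : C) : factors_proj K (idm A) -> projective K A.
Proof. by move=> [P [g [h [pP e]]]]; apply: (projective_retract (esym e)). Qed.

Lemma stab_iso (A B : C) (f : Hom A B) (g : Hom B A) :
  factors_proj K (g \oc f - idm A) -> factors_proj K (f \oc g - idm B) ->
  @isomorphic (stabCat K) A B.
Proof.
move=> /stab_pi_eq e1 /stab_pi_eq e2; exists (stab_pi K f), (stab_pi K g).
by split; [exact: etrans (stab_pi_comp _ _ _) e1 | exact: etrans (stab_pi_comp _ _ _) e2].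
Qed.

Lemma stab_isoE (A B : C) : @isomorphic (stabCat K) A B ->
  exists (f : Hom A B) (g : Hom B A),
    factors_proj K (g \oc f - idm A) /\ factors_proj K (f \oc g - idm B).
Proof.
move=> [f [g [gf fg]]]; exists (repr f), (repr g); split; apply/stab_pi_eq.
  by rewrite -stab_pi_comp !stab_pi_repr; apply: gf.
by rewrite -stab_pi_comp !stab_pi_repr; apply: fg.
Qed.

End NullMaps.

Section FrobeniusCategories.
Local Open Scope ring_scope.
Variables (F : exactCat) (hF : frobenius F).
Implicit Types A B D T : F.
Local Notation cf f g := (conf _ _ _ f g).
Local Notation infl := (inflation (@conf F)).
Local Notation defl := (deflation (@conf F)).
Local Notation proj := (projective (@conf F)).
Local Notation null := (factors_proj (@conf F)).

Lemma proj_extend P A B (f : Hom A B) (x : Hom A P) :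
  proj P -> infl f -> exists y : Hom B P, y \oc f = x.
Proof. by case: hF => _ _ pi /pi iP /iP. Qed.

Lemma exists_proj_infl A : exists (P : F) (i : Hom A P), proj P /\ infl i.
Proof. by case: hF => _ /(_ A)[P [i [iP ii]]] pi; exists P, i; split=> //; apply/pi. Qed.

Lemma exists_proj_defl A : exists (P : F) (p : Hom P A), proj P /\ defl p.
Proof. by case: hF. Qed.

Lemma proj_ext A B D (f : Hom A B) (g : Hom B D) : cf f g -> proj A -> proj D -> proj B.
Proof.
move=> cg pA pD; have [|s gs] := pD _ _ g _ (idm D); first by exists A, f.
have [r [_ e]] := conf_section cg gs.
apply: (@projective_retract _ _ (biprod A D) _ (inl_ A D \oc r + inr_ A D \oc g)
  (f \oc prl A D + s \oc prr A D)); first by rewrite copair_pair.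
exact: projective_biprod.
Qed.

Lemma proj_quot A B D (f : Hom A B) (g : Hom B D) : cf f g -> proj A -> proj B -> proj D.
Proof.
move=> cg pA; have [|r rf] := @proj_extend A _ _ f (idm A) pA; first by exists D, g.
have [s [gs _]] := conf_retraction cg rf; exact: projective_retract gs.
Qed.

Lemma proj_sub A B D (f : Hom A B) (g : Hom B D) : cf f g -> proj B -> proj D -> proj A.
Proof.
move=> cg pB pD; have [|s gs] := pD _ _ g _ (idm D); first by exists A, f.
have [r [rf _]] := conf_section cg gs; exact: projective_retract rf pB.
Qed.

(** The trivial cofibrations of a Frobenius category: the inflations that become invertible in the
    stable category. *)
Definition pinfl A B (f : Hom A B) : Prop :=
  exists (D : F) (g : Hom B D), cf f g /\ proj D.

Lemma pinfl_infl A B (f : Hom A B) : pinfl f -> infl f.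
Proof. by move=> [D [g []]]; exists D, g. Qed.

Lemma pinfl_id A : pinfl (idm A).
Proof. by exists zob, 0; split; [exact: conf_id0 | exact: projective_zob]. Qed.

Lemma pinfl_comp A B D (f : Hom A B) (g : Hom B D) :
  pinfl f -> pinfl g -> pinfl (g \oc f).
Proof.
move=> [X [p [cp pX]]] [Y [q [cq pY]]].
have [Z [n [c [r [cn cr _ _]]]]] := noether cp cq.
by exists Z, n; split=> //; apply: proj_ext cr pX pY.
Qed.

Lemma pinfl_proj A B (f : Hom A B) : infl f -> proj A -> proj B -> pinfl f.
Proof. by move=> [D [g cg]] pA pB; exists D, g; split=> //; apply: proj_quot cg pA pB. Qed.

Lemma pinfl_target A B (f : Hom A B) : pinfl f -> proj A -> proj B.
Proof. by move=> [D [g [cg pD]]] pA; apply: proj_ext cg pA pD. Qed.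

Lemma pinfl_pushout A B A' D (f : Hom A B) (a : Hom A A')
    (b : Hom B D) (f' : Hom A' D) :
  is_pushout f a b f' -> pinfl f -> pinfl f'.
Proof.
by move=> po [X [g [cg pX]]]; have [q [_ _ cq]] := conf_pushout_ex po cg; exists X, q.
Qed.

(** A stable inverse [r] becomes a genuine retraction after subtracting a map through a projective,
    since projectives are injective. The identity of the cokernel is then null, which makes the
    cokernel projective. *)
Lemma pinfl_stab_iso A B (f : Hom A B) (r : Hom B A) :
  infl f -> null (r \oc f - idm A) -> null (f \oc r - idm B) -> pinfl f.
Proof.
move=> inf [P [x [y [pP e]]]] n2; have [D [g cg]] := inf.
have [x' ex] := proj_extend x pP inf.
have rf : (r - y \oc x') \oc f = idm A.
  by rewrite compBl -compA ex -e opprB addrC subrK.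
have [s [gs es]] := conf_retraction cg rf.
exists D, g; split=> //; apply: (@projective_null _ _ _).
have -> : idm D = g \oc (s \oc g) \oc s by rewrite compA gs comp1m.
apply: factors_proj_compr; apply: factors_proj_compl.
(* The idempotent [s \oc g] is the identity minus [f] composed with the corrected retraction: a map
   through [P] minus a null map. *)
have -> : s \oc g = f \oc (y \oc x') - (f \oc r - idm B).
  by rewrite -[LHS](addKr (f \oc (r - y \oc x'))) es compBr !opprB addrA addrAC.
apply: factors_projB => //; rewrite compA; exact: factors_proj_through.
Qed.

Section ThreeByThree.
Variables (A B D A' B' D' : F).
Variables (f : Hom A B) (g : Hom B D) (f' : Hom A' B') (g' : Hom B' D').
Variables (a : Hom A A') (b : Hom B B') (d : Hom D D').
Hypotheses (cg : cf f g) (cg' : cf f' g') (sqf : b \oc f = f' \oc a)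
  (sqg : d \oc g = g' \oc b).

Lemma pinfl_middle : pinfl a -> pinfl d -> pinfl b.
Proof.
move=> [X [a' [ca pX]]] [Z [d' [cd pZ]]].
have [||Y [b' cb]] := infl_middle cg cg' sqf sqg; [by exists X, a' | by exists Z, d' |].
have [u [v cu]] := three_by_three cg cg' sqf sqg ca cb cd.
by exists Y, b'; split=> //; apply: proj_ext cu pX pZ.
Qed.

Lemma pinfl_right : infl d -> pinfl a -> pinfl b -> pinfl d.
Proof.
move=> [Z [d' cd]] [X [a' [ca pX]]] [Y [b' [cb pY]]].
have [u [v cu]] := three_by_three cg cg' sqf sqg ca cb cd.
by exists Z, d'; split=> //; apply: proj_quot cu pX pY.
Qed.

Lemma pinfl_left : infl a -> pinfl b -> pinfl d -> pinfl a.
Proof.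
move=> [X [a' ca]] [Y [b' [cb pY]]] [Z [d' [cd pZ]]].
have [u [v cu]] := three_by_three cg cg' sqf sqg ca cb cd.
by exists X, a'; split=> //; apply: proj_sub cu pY pZ.
Qed.

End ThreeByThree.

End FrobeniusCategories.

(** * Dependent choice along the positions of a chain *)

Section ChainChoice.
Variable l : nat.

Lemma dependent_choice_fam (I : Type) (T : I -> Type) (P : forall i, T i -> Prop) :
  (forall i, exists y, P i y) -> exists f : forall i, T i, forall i, P i (f i).
Proof. by move=> H; exists (fun i => projT1 (cid (H i))) => i; case: (cid _). Qed.

Lemma tgtE (k : 'I_l) : tgt k = k.+1 :> nat. Proof. by []. Qed.

Lemma bump0 n : bump 0 n = n.+1. Proof. by []. Qed.

Lemma tgt_pred (i : 'I_l.+1) : 0 < i -> exists k : 'I_l, i = tgt k.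
Proof.
case: i => [[|n] ni] // _; exists (Ordinal (ni : n < l)); exact: val_inj.
Qed.

Lemma src_of (i : 'I_l.+1) : i < l -> exists k : 'I_l, i = src k.
Proof. by move=> il; exists (Ordinal il); apply: val_inj. Qed.

Lemma src_inj (k k' : 'I_l) : src k = src k' -> k = k'.
Proof. by move=> /(congr1 val) /= e; apply: val_inj. Qed.

Lemma tgt_inj (k k' : 'I_l) : tgt k = tgt k' -> k = k'.
Proof. exact: lift_inj. Qed.

Lemma tgt_neq (j : 'I_l.+1) (k : 'I_l) : j <= k -> tgt k <> j.
Proof. by move=> jk e; move: jk; rewrite -e tgtE ltnn. Qed.

Lemma src_neq (j : 'I_l.+1) (k : 'I_l) : k < j -> src k <> j.
Proof. by move=> kj e; move: kj; rewrite -e ltnn. Qed.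

Section Untyped.
Variables (j : 'I_l.+1) (T : 'I_l.+1 -> Type).
Variable R : forall k : 'I_l, T (src k) -> T (tgt k) -> Prop.
Arguments R : clear implicits.
Hypotheses (t0 : T j)
  (up : forall k : 'I_l, j <= k -> forall t, exists t', R k t t')
  (down : forall k : 'I_l, k < j -> forall t', exists t, R k t t').

Let inhabited_up n : forall i : 'I_l.+1, i = j + n :> nat -> exists t : T i, True.
Proof.
elim: n => [|n IH] i; first by rewrite addn0 => /val_inj ->; exists t0.
rewrite addnS => e; have [|k ek] := @tgt_pred i; first by rewrite e.
subst i; have {}e : k = j + n :> nat by case: e.
have [t _] := IH (src k) e; have [|t' _] := up _ t; first by rewrite e leq_addr.
by exists t'.
Qed.

Let inhabited_down n : forall i : 'I_l.+1, j = i + n :> nat -> exists t : T i, True.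
Proof.
elim: n => [|n IH] i; first by rewrite addn0 => /val_inj <-; exists t0.
move=> e; have [|k ek] := @src_of i.
  by rewrite -ltnS; apply: leq_ltn_trans (ltn_ord j); rewrite e addnS ltnS leq_addr.
subst i; have [|t _] := IH (tgt k); first by rewrite e addnS.
by have [|t' _] := down _ t; [rewrite e addnS ltnS leq_addr | exists t'].
Qed.

(** A recursion along positions would have to transport between the target of one arrow and the
    source of the next. Instead an arbitrary family is repaired one position at a time with
    [dfwith], upwards from [j] and then downwards. *)
Lemma chain_choice_aux : exists t : forall k, T k, forall k, R k (t (src k)) (t (tgt k)).
Proof.
have [t _] : exists t : forall k, T k, 'I_l.+1 -> True.
  apply: (@dependent_choice_fam _ T (fun=> fun=> True)) => i; case: (leqP j i) => ji.
    by have [|t] := @inhabited_up (i - j) i; [rewrite subnKC | exists t].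
  by have [|t] := @inhabited_down (j - i) i; [rewrite subnKC // ltnW | exists t].
have {t} [t tup] : exists t : forall k, T k,
    forall k : 'I_l, j <= k < l -> R k (t (src k)) (t (tgt k)).
  suff H n : exists t : forall k, T k,
      forall k : 'I_l, j <= k < n -> R k (t (src k)) (t (tgt k)) by exact: H.
  elim: n => [|n [u Hu]]; first by exists t => k; rewrite ltn0 andbF.
  case: (boolP (j <= n < l)) => [/andP[jn nl]|jnl]; last first.
    exists u => k /andP[jk kn]; apply: Hu; rewrite jk /=.
    move: kn; rewrite ltnS leq_eqVlt => /orP[/eqP e|//].
    by move: jnl; rewrite -e jk ltn_ord.
  (* Changing the value at [tgt m] alone settles the arrow [m]; the arrows already treated do not
     meet that position. *)
  pose m := Ordinal nl; have [|t' Ht'] := @up m _ (u (src m)); first by [].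
  exists (dfwith u t') => k /andP[jk kn].
  have nsrc : tgt m != src k by rewrite -val_eqE /= gtn_eqF.
  rewrite (dfwith_out _ _ nsrc); have [ekm|/eqP nkm] := pselect (k = m).
    by subst k; rewrite dfwith_in.
  rewrite dfwith_out; last by apply: contraNneq nkm => /tgt_inj ->.
  apply: Hu; rewrite jk ltn_neqAle -ltnS kn andbT.
  by apply: contraNneq nkm => e; apply/eqP/val_inj.
suff H n : exists t : forall k, T k,
    forall k : 'I_l, (j <= k) || (j - n <= k) -> R k (t (src k)) (t (tgt k)).
  by have [u Hu] := H j; exists u => k; apply: Hu; rewrite subnn orbT.
elim: n => [|n [u Hu]].
  by exists t => k; rewrite subn0 orbb => jk; apply: tup; rewrite jk ltn_ord.
case: (boolP (n < j)) => [nj|]; last first.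
  (* Once [n] reaches [j] the truncated difference [j - n] is zero and every arrow is covered. *)
  rewrite -leqNgt => jn; exists u => k _; apply: Hu.
  by move/eqP: jn => ->; rewrite orbT.
have ml : j - n.+1 < l.
  by rewrite -subSn // subSS -ltnS; apply: leq_ltn_trans (leq_subr _ _) _.
pose m := Ordinal ml; have [|t' Ht'] := @down m _ (u (tgt m)).
  by rewrite /= ltn_subrL /= (leq_ltn_trans _ nj).
exists (dfwith u t') => k Hk.
have [ekm|/eqP nkm] := pselect (k = m).
  subst k; rewrite dfwith_in dfwith_out //.
  by rewrite -val_eqE /= ltn_eqF.
have Hk' : (j <= k) || (j - n <= k).
  case/orP: Hk => [->//|Hk]; rewrite orbC -subnSK // ltn_neqAle Hk andbT.
  by apply/orP; left; apply: contraNneq nkm => e; apply/eqP/val_inj.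
rewrite dfwith_out; last by apply: contraNneq nkm => /src_inj ->.
rewrite dfwith_out; first exact: Hu.
rewrite -val_eqE /=; apply: contraTneq Hk' => e.
rewrite negb_or -!ltnNge; have : k.+1 <= j - n.+1 by rewrite e /bump leq0n.
move=> Hl; rewrite (leq_trans Hl) ?leq_subr //=.
by apply: (leq_trans Hl); rewrite leq_sub2l.
Qed.

End Untyped.

(** The tool that builds chains, ladders and factorizations: start at position [j] and extend in
    both directions. Placing [Inv] in a subtype makes the extension steps total, as
    [chain_choice_aux] demands. *)
Lemma chain_choice (j : 'I_l.+1) (T : 'I_l.+1 -> Type) (Inv : forall k, T k -> Prop)
    (R : forall k : 'I_l, T (src k) -> T (tgt k) -> Prop) :
  (exists t, Inv j t) ->
  (forall k : 'I_l, j <= k -> forall t, Inv (src k) t ->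
    exists t', Inv (tgt k) t' /\ R k t t') ->
  (forall k : 'I_l, k < j -> forall t', Inv (tgt k) t' ->
    exists t, Inv (src k) t /\ R k t t') ->
  exists t : forall k, T k, (forall k, Inv k (t k)) /\ forall k, R k (t (src k)) (t (tgt k)).
Proof.
move=> [t0 i0] up down.
pose S k := {t : T k | Inv k t}.
have [||t Ht] := @chain_choice_aux j S (fun k t t' => R k (sval t) (sval t')) (exist _ t0 i0).
- by move=> k jk [t it]; have [t' [it' r]] := up k jk t it; exists (exist _ t' it').
- by move=> k jk [t it]; have [t' [it' r]] := down k jk t it; exists (exist _ t' it').
by exists (fun k => sval (t k)); split=> // k; case: (t k).
Qed.

End ChainChoice.

(** * Chains of inflations *)

Section ChainCategory.
Local Open Scope ring_scope.
Variables (F : exactCat) (l : nat).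
Local Notation M := (chainCat F l).
Local Notation cc := (@chain_conf F l).

Lemma ladder_at (X Y : chain F l) (f g : ladder X Y) : f = g -> forall k, f k = g k.
Proof. by move=> ->. Qed.

(** Meant for predicates that determine each term uniquely, as universal properties do: the squares
    then commute whichever terms are chosen. *)
Lemma choose_ladder (X Y : chain F l) (P : forall k, Hom (X k) (Y k) -> Prop) :
  (forall k, exists f, P k f) ->
  (forall k f f', P (src k) f -> P (tgt k) f' -> ch_map Y k \oc f = f' \oc ch_map X k) ->
  exists f : ladder X Y, forall k, P k (f k).
Proof.
move=> ex comm; have [f Pf] := dependent_choice_fam ex.
have fc k : ch_map Y k \oc f (src k) = f (tgt k) \oc ch_map X k by exact: comm.
by exists (Ladder fc).
Qed.

Lemma chain_conf_kernel (X Y Z : M) (f : Hom X Y) (g : Hom Y Z) :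
  cc f g -> is_kernel f g.
Proof.
move=> cg; split; first by apply: ladder_ext => k; apply: (conf0 (cg k)).
move=> T x gx0.
have [|k y y' ey ey'|h eh] := @choose_ladder T X
    (fun k y => (f : ladder X Y) k \oc y = (x : ladder T Y) k).
- by move=> k; apply: (conf_lift (cg k)); exact: ladder_at gx0 k.
- apply: (conf_mono (cg (tgt k))).
  by rewrite !compA ey' -ld_comm -compA ey ld_comm.
exists h; split; first exact: ladder_ext.
move=> h' e; apply: ladder_ext => k; apply: (conf_mono (cg k)).
by rewrite eh -(ladder_at e k).
Qed.

Lemma chain_conf_cokernel (X Y Z : M) (f : Hom X Y) (g : Hom Y Z) :
  cc f g -> is_cokernel f g.
Proof.
move=> cg; split; first by apply: ladder_ext => k; apply: (conf0 (cg k)).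
move=> T x xf0.
have [|k y y' ey ey'|h eh] := @choose_ladder Z T
    (fun k y => y \oc (g : ladder Y Z) k = (x : ladder Y T) k).
- by move=> k; apply: (conf_desc (cg k)); exact: ladder_at xf0 k.
- apply: (conf_epi (cg (src k))).
  by rewrite -compA ey ld_comm -compA ld_comm compA ey'.
exists h; split; first exact: ladder_ext.
move=> h' e; apply: ladder_ext => k; apply: (conf_epi (cg k)).
by rewrite eh -(ladder_at e k).
Qed.

(* Stated apart from [conf_section] because chains are not shown to form an exact category:
   that conflations are kernel-cokernel pairs is enough. *)
Lemma chain_conf_section (X Y Z : M) (f : Hom X Y) (g : Hom Y Z) (s : Hom Z Y) :
  cc f g -> g \oc s = idm Z ->
  exists r : Hom Y X, r \oc f = idm X /\ f \oc r + s \oc g = idm Y.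
Proof.
move=> cg gs; have kf := chain_conf_kernel cg.
have [|r er] := @kernel_lift _ _ _ _ _ _ _ (idm Y - s \oc g) kf.
  by rewrite compBr compm1 compA gs comp1m subrr.
exists r; split; last by rewrite er subrK.
apply: (kernel_mono kf); rewrite compA er compBl comp1m -compA kf.1 compm0 subr0.
by rewrite compm1.
Qed.

End ChainCategory.

(** * Projective and injective chains *)

Section FrobeniusChains.
Local Open Scope ring_scope.
Variables (F : exactCat) (hF : frobenius F) (l : nat).
Local Notation cf f g := (conf _ _ _ f g).
Local Notation infl := (inflation (@conf F)).
Local Notation defl := (deflation (@conf F)).
Local Notation proj := (projective (@conf F)).
Local Notation M := (chainCat F l).
Local Notation cc := (@chain_conf F l).

(** Extensions are corrected position by position: the failure of the next square to commute
    vanishes on [A], descends to [D], and extends along the arrow of [D] because the terms of [J]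
    are injective. *)
Lemma termwise_injective (J : chain F l) : (forall k, proj (J k)) -> injective_ob cc (J : M).
Proof.
move=> pJ A B f [D [g cg]] x.
have infk k : infl ((f : ladder A B) k) by exists ((D : chain F l) k), ((g : ladder B D) k).
have [|k _ y ey|//|y [ey Ry]] := @chain_choice l ord0
  (fun k => Hom ((B : chain F l) k) (J k))
  (fun k y => y \oc (f : ladder A B) k = (x : ladder A J) k)
  (fun k y y' => ch_map J k \oc y = y' \oc ch_map (B : chain F l) k).
- exact: proj_extend.
- have [z ez] := proj_extend hF ((x : ladder A J) (tgt k)) (pJ (tgt k)) (infk (tgt k)).
  have [|e ee] := @conf_desc _ _ _ _ _ _ _
    (ch_map J k \oc y - z \oc ch_map (B : chain F l) k) (cg (src k)).
    by rewrite compBl -!compA ey !ld_comm compA ez subrr.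
  have [e' ee'] := proj_extend hF e (pJ (tgt k)) (ch_infl (D : chain F l) k).
  exists (z + e' \oc (g : ladder B D) (tgt k)); split.
    by rewrite compDl ez -compA (conf0 (cg (tgt k))) compm0 addr0.
  by rewrite compDl -!compA -(ld_comm (g : ladder B D)) (comp_pre ee') ee addrC subrK.
- by exists (Ladder Ry); apply: ladder_ext => k; apply: ey.
Qed.

(** The failure of the next square to commute is killed by [g], so it may be added to the lift after
    composition with a retraction of the arrow of [P], which exists because projective terms are
    injective. *)
Lemma termwise_projective (P : chain F l) : (forall k, proj (P k)) -> projective cc (P : M).
Proof.
move=> pP B D g [A [f cg]] x.
have dg k : defl ((g : ladder B D) k) by exists ((A : chain F l) k), ((f : ladder A B) k).
have [|k _ y ey|//|y [ey Ry]] := @chain_choice l ord0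
  (fun k => Hom (P k) ((B : chain F l) k))
  (fun k y => (g : ladder B D) k \oc y = (x : ladder P D) k)
  (fun k y y' => ch_map (B : chain F l) k \oc y = y' \oc ch_map P k).
- by apply: pP.
- have [z ez] := pP (tgt k) _ _ _ (dg (tgt k)) ((x : ladder P D) (tgt k)).
  have [r er] := proj_extend hF (idm (P (src k))) (pP (src k)) (ch_infl P k).
  exists (z + (ch_map (B : chain F l) k \oc y - z \oc ch_map P k) \oc r); split.
    rewrite compDr ez compA compBr compA -(ld_comm (g : ladder B D)) -compA ey compA ez.
    by rewrite ld_comm subrr comp0m addr0.
  by rewrite compDl -!compA er compm1 addrC subrK.
- by exists (Ladder Ry); apply: ladder_ext => k; apply: ey.
Qed.

Lemma conf_inl (A B : F) : cf (inl_ A B) (prr A B).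
Proof.
apply: conf_cokernel; first exact: infl_inl.
split=> [|T x e]; first exact: prr_inl.
exists (x \oc inr_ A B); split.
  apply: biprod_ext; rewrite -compA ?prr_inl ?prr_inr ?compm1 //.
  by rewrite compm0 e.
by move=> h <-; rewrite -compA prr_inr compm1.
Qed.

(** A conflation as a single datum, so that [chain_choice] can select one at each position. *)
Record confl := Confl {
  cf1 : F; cf2 : F; cf3 : F;
  cfi : Hom cf1 cf2; cfp : Hom cf2 cf3; cfP : cf cfi cfp }.

Definition confl_infl (s t : confl) (a : Hom (cf1 s) (cf1 t)) (b : Hom (cf2 s) (cf2 t))
    (d : Hom (cf3 s) (cf3 t)) : Prop :=
  [/\ infl a, infl b, infl d, b \oc cfi s = cfi t \oc a & d \oc cfp s = cfp t \oc b].

Lemma confl_infl_id (s : confl) : confl_infl (idm (cf1 s)) (idm _) (idm _).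
Proof. by split; rewrite ?comp1m ?compm1 //; apply: infl_id (exactP F) _. Qed.

(* A lifting problem at position [k] is extended to a ladder from [P] to a chain that is [D]
   up to [k] and injective beyond. [Inv] carries the solution back to position [k] as an
   implication, which avoids transports along [i = k]. *)
Lemma projective_termwise (P : chain F l) : projective cc (P : M) -> forall k, proj (P k).
Proof.
move=> pP k B D g [A [f cg]] x.
pose T i := {c : confl & Hom (P i) (cf3 c)}.
pose Inv i (t : T i) := i = k ->
  (exists y, cfp (projT1 t) \oc y = projT2 t) -> exists y, g \oc y = x.
pose R (i : 'I_l) (t : T (src i)) (t' : T (tgt i)) :=
  exists w : Hom (cf1 (projT1 t)) (cf1 (projT1 t')) *
         Hom (cf2 (projT1 t)) (cf2 (projT1 t')) *
         Hom (cf3 (projT1 t)) (cf3 (projT1 t')),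
  confl_infl w.1.1 w.1.2 w.2 /\ w.2 \oc projT2 t = projT2 t' \oc ch_map P i.
have [|i ki [[A1 B1 D1 f1 g1 c1] x1] _|i ik [c x1] _|t [It /dependent_choice_fam[w Hw]]] :=
  @chain_choice l k T Inv R.
- by exists (existT _ (Confl cg) x).
- have [IA [a [pIA ia]]] := exists_proj_infl hF A1.
  have [ID [d [pID id_]]] := exists_proj_infl hF D1.
  have [a' ea] : exists a' : Hom B1 IA, a' \oc f1 = a.
    by apply: proj_extend => //; exists D1, g1.
  have [x' ex] := proj_extend hF (d \oc x1) pID (ch_infl P i).
  exists (existT _ (Confl (conf_inl IA ID)) x'); split.
    by move=> /(tgt_neq ki).
  pose b := inl_ IA ID \oc a' + inr_ IA ID \oc (d \oc g1).
  have bf : b \oc f1 = inl_ IA ID \oc a.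
    by rewrite /b compDl -!compA ea (conf0 c1) !compm0 addr0.
  have dg : d \oc g1 = prr IA ID \oc b by rewrite pair_prr.
  exists (a, b, d); split=> //; split=> //=.
  exact: infl_middle c1 (conf_inl _ _) bf dg ia id_.
- exists (existT _ c (x1 \oc ch_map P i)); split.
    by move=> /(src_neq ik).
  by exists (idm _, idm _, idm _); split; [exact: confl_infl_id | exact: comp1m].
pose X1 := @Chain F l (fun i => cf1 (projT1 (t i))) (fun i => (w i).1.1)
  (fun i => let: conj (And5 h _ _ _ _) _ := Hw i in h).
pose X2 := @Chain F l (fun i => cf2 (projT1 (t i))) (fun i => (w i).1.2)
  (fun i => let: conj (And5 _ h _ _ _) _ := Hw i in h).
pose X3 := @Chain F l (fun i => cf3 (projT1 (t i))) (fun i => (w i).2)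
  (fun i => let: conj (And5 _ _ h _ _) _ := Hw i in h).
pose f' := @Ladder F l X1 X2 (fun i => cfi (projT1 (t i)))
  (fun i => let: conj (And5 _ _ _ h _) _ := Hw i in h).
pose g' := @Ladder F l X2 X3 (fun i => cfp (projT1 (t i)))
  (fun i => let: conj (And5 _ _ _ _ h) _ := Hw i in h).
pose x' := @Ladder F l P X3 (fun i => projT2 (t i))
  (fun i => let: conj _ h := Hw i in h).
have [|y ey] := pP X2 X3 g' _ x'.
  by exists X1, f' => i; apply: cfP.
by apply: (It k) => //; exists ((y : ladder P X2) k); apply: ladder_at ey k.
Qed.

(** An extension problem at position [k] becomes one between chains that vanish below [k] and are
    constant from [k] on. As in [projective_termwise], [Inv] carries the solution back to [k]. *)
Lemma injective_termwise (J : chain F l) : injective_ob cc (J : M) -> forall k, proj (J k).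
Proof.
move=> iJ k; case: hF => _ _ pi; apply/pi => A B f [D [g cg]] x.
pose T i := {c : confl & Hom (cf1 c) (J i)}.
pose Inv i (t : T i) := i = k ->
  (exists y, y \oc cfi (projT1 t) = projT2 t) -> exists y, y \oc f = x.
pose R (i : 'I_l) (t : T (src i)) (t' : T (tgt i)) :=
  exists w : Hom (cf1 (projT1 t)) (cf1 (projT1 t')) *
         Hom (cf2 (projT1 t)) (cf2 (projT1 t')) *
         Hom (cf3 (projT1 t)) (cf3 (projT1 t')),
  confl_infl w.1.1 w.1.2 w.2 /\ ch_map J i \oc projT2 t = projT2 t' \oc w.1.1.
have [|i ki [c x1] _|i ik [c x1] _|t [It /dependent_choice_fam[w Hw]]] :=
  @chain_choice l k T Inv R.
- by exists (existT _ (Confl cg) x).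
- exists (existT _ c (ch_map J i \oc x1)); split.
    by move=> /(tgt_neq ki).
  by exists (idm _, idm _, idm _); split; [exact: confl_infl_id | rewrite /= compm1].
- have c0 := @conf_id0 F zob.
  exists (existT _ (Confl c0) (0 : Hom zob (J (src i)))); split.
    by move=> /(src_neq ik).
  have i0 (A0 : F) : infl (0 : Hom zob A0) by exists A0, (idm A0); exact: conf_0id.
  exists (0, 0, 0); split; first by split=> //=; rewrite ?comp0m ?compm0.
  by rewrite /= !compm0.
pose X1 := @Chain F l (fun i => cf1 (projT1 (t i))) (fun i => (w i).1.1)
  (fun i => let: conj (And5 h _ _ _ _) _ := Hw i in h).
pose X2 := @Chain F l (fun i => cf2 (projT1 (t i))) (fun i => (w i).1.2)
  (fun i => let: conj (And5 _ h _ _ _) _ := Hw i in h).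
pose X3 := @Chain F l (fun i => cf3 (projT1 (t i))) (fun i => (w i).2)
  (fun i => let: conj (And5 _ _ h _ _) _ := Hw i in h).
pose f' := @Ladder F l X1 X2 (fun i => cfi (projT1 (t i)))
  (fun i => let: conj (And5 _ _ _ h _) _ := Hw i in h).
pose g' := @Ladder F l X2 X3 (fun i => cfp (projT1 (t i)))
  (fun i => let: conj (And5 _ _ _ _ h) _ := Hw i in h).
pose x' := @Ladder F l X1 J (fun i => projT2 (t i))
  (fun i => let: conj _ h := Hw i in h).
have [|y ey] := iJ X1 X2 f' _ x'.
  by exists X3, g' => i; apply: cfP.
by apply: (It k) => //; exists ((y : ladder X2 J) k); apply: ladder_at ey k.
Qed.

(** A Reedy-type construction: the next injective term receives an inflation from the pushout [P] of
    the previous one along the arrow of [X]. Both legs into it are then inflations, and [noether]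
    gives the inflation between the cokernels. *)
Lemma chain_enough_injectives (X : chain F l) :
  exists (I C : chain F l) (i : ladder X I) (p : ladder I C),
    (forall k, proj (I k)) /\ cc (i : @Hom M X I) (p : @Hom M I C).
Proof.
pose T k := {c : F * F & (Hom (X k) c.1 * Hom c.1 c.2)%type}.
pose Inv k (t : T k) := proj (projT1 t).1 /\ cf (projT2 t).1 (projT2 t).2.
pose R (k : 'I_l) (t : T (src k)) (t' : T (tgt k)) :=
  exists w : Hom (projT1 t).1 (projT1 t').1 * Hom (projT1 t).2 (projT1 t').2,
  [/\ infl w.1, infl w.2, w.1 \oc (projT2 t).1 = (projT2 t').1 \oc ch_map X k
    & w.2 \oc (projT2 t).2 = (projT2 t').2 \oc w.1].
have [|k _ [[I C] [i p]] [/= pI cp]|//|t [It /dependent_choice_fam[w Hw]]] :=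
  @chain_choice l ord0 T Inv R.
- have [I [i [pI [C [p cp]]]]] := exists_proj_infl hF (X ord0).
  by exists (existT _ (I, C) (i, p)).
- have ii : infl i by exists C, p.
  have [P [b [f' [po _]]]] := infl_push (exactP F) (ch_map X k) ii.
  have [q [qb _ cq]] := conf_pushout_ex po cp.
  have [J [m [pJ [K [r cm]]]]] := exists_proj_infl hF P.
  have [C' [n [c [s [cn cs cq' _]]]]] := noether cq cm.
  exists (existT _ (J, C') (m \oc f', n)); split; first by [].
  exists (m \oc b, c); split=> /=.
  + apply: (infl_comp (exactP F)); last by exists K, r.
    exact: infl_pushout (pushout_sym po) (ch_infl X k).
  + by exists K, s.
  + by rewrite -!compA po.1.
  + by rewrite compA -cq' -compA qb.
pose I := @Chain F l (fun k => (projT1 (t k)).1) (fun k => (w k).1)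
    (fun k => let: And4 h _ _ _ := Hw k in h).
pose C := @Chain F l (fun k => (projT1 (t k)).2) (fun k => (w k).2)
    (fun k => let: And4 _ h _ _ := Hw k in h).
exists I, C, (@Ladder F l X I (fun k => (projT2 (t k)).1)
    (fun k => let: And4 _ _ h _ := Hw k in h)),
  (@Ladder F l I C (fun k => (projT2 (t k)).2)
    (fun k => let: And4 _ _ _ h := Hw k in h)).
by split=> k; case: (It k).
Qed.

End FrobeniusChains.

(** * Triangles of chains *)

Section ChainTriangles.
Local Open Scope ring_scope.
Variables (F : exactCat) (hF : frobenius F) (l : nat).
Local Notation cf f g := (conf _ _ _ f g).
Local Notation infl := (inflation (@conf F)).
Local Notation proj := (projective (@conf F)).
Local Notation null := (factors_proj (@conf F)).
Local Notation M := (chainCat F l).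
Local Notation cc := (@chain_conf F l).

Lemma null_termwise (X Y : chain F l) (f : ladder X Y) :
  factors_proj cc (f : @Hom M X Y) -> forall k, null (f k).
Proof.
move=> [P [g [h [pP e]]]] k; exists ((P : chain F l) k), ((g : ladder X P) k),
  ((h : ladder P Y) k).
by split; [exact: projective_termwise | exact: ladder_at e k].
Qed.

Lemma chain_hullP (X : M) : is_hull cc (the_hull cc X).
Proof.
rewrite /the_hull; case: pselect => [ex|[]]; first by case: (cid ex).
have [I [C [i [p [pI ci]]]]] := chain_enough_injectives hF X.
exists (@Hull M X I C i p); split=> //.
exact: termwise_injective.
Qed.

Lemma hull_proj (X : M) (k : 'I_l.+1) : proj ((hull_ob (the_hull cc X) : chain F l) k).
Proof. exact: (injective_termwise hF (chain_hullP X).1). Qed.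

(** Pushouts are taken termwise; the induced arrows of [Z] are inflations by [infl_middle], because
    each term of [Z] extends that of [C] by that of [Y]. *)
Lemma chain_pushout_ex (X I C Y : chain F l) (i : ladder X I) (p : ladder I C)
    (u : ladder X Y) : cc (i : @Hom M X I) (p : @Hom M I C) ->
  exists (Z : chain F l) (j : ladder I Z) (v : ladder Y Z) (q : ladder Z C),
  [/\ forall k, is_pushout (i k) (u k) (j k) (v k),
      forall k, q k \oc j k = p k & forall k, q k \oc v k = 0].
Proof.
move=> cp.
have /dependent_choice_fam[Z] : forall k,
    exists Zk : F, exists t : Hom (I k) Zk * Hom (Y k) Zk * Hom Zk (C k),
    [/\ is_pushout (i k) (u k) t.1.1 t.1.2, t.2 \oc t.1.1 = p k,
        t.2 \oc t.1.2 = 0 & cf t.1.2 t.2].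
  move=> k; have ii : infl (i k) by exists (C k), (p k).
  have [Zk [b [f' [po _]]]] := infl_push (exactP F) (u k) ii.
  have [q [qb qf cq]] := conf_pushout_ex po (cp k).
  by exists Zk, (b, f', q).
move=> /dependent_choice_fam[t Ht].
have /dependent_choice_fam[h Hh] : forall k : 'I_l, exists h : Hom (Z (src k)) (Z (tgt k)),
    [/\ infl h, h \oc (t (src k)).1.1 = (t (tgt k)).1.1 \oc ch_map I k,
        h \oc (t (src k)).1.2 = (t (tgt k)).1.2 \oc ch_map Y k &
        ch_map C k \oc (t (src k)).2 = (t (tgt k)).2 \oc h].
  move=> k; have [po qj qv cq] := Ht (src k); have [po' qj' qv' cq'] := Ht (tgt k).
  have [|h [hj hv]] := @pushout_desc _ _ _ _ _ _ _ _ _ _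
      ((t (tgt k)).1.1 \oc ch_map I k) ((t (tgt k)).1.2 \oc ch_map Y k) po.
    by rewrite -!compA !ld_comm !compA po'.1.
  have sq : ch_map C k \oc (t (src k)).2 = (t (tgt k)).2 \oc h.
    apply: (pushout_ext po); rewrite -!compA ?qj ?qv ?hj ?hv ?compm0.
      by rewrite compA qj' ld_comm.
    by rewrite compA qv' comp0m.
  exists h; split=> //.
  exact: infl_middle cq cq' hv sq (ch_infl Y k) (ch_infl C k).
pose ZZ := @Chain F l Z h (fun k => let: And4 e _ _ _ := Hh k in e).
exists ZZ, (@Ladder F l I ZZ (fun k => (t k).1.1) (fun k => let: And4 _ e _ _ := Hh k in e)),
  (@Ladder F l Y ZZ (fun k => (t k).1.2) (fun k => let: And4 _ _ e _ := Hh k in e)),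
  (@Ladder F l ZZ C (fun k => (t k).2) (fun k => let: And4 _ _ _ e := Hh k in e)).
by split=> k /=; case: (Ht k).
Qed.

Lemma termwise_pushout (X I Y Z : chain F l) (i : ladder X I) (u : ladder X Y)
    (j : ladder I Z) (v : ladder Y Z) :
  (forall k, is_pushout (i k) (u k) (j k) (v k)) ->
  @is_pushout M X I Y Z i u j v.
Proof.
move=> po; apply: pushoutI => [|T x y ej ev|T x y e].
- by apply: ladder_ext => k; apply: (po k).1.
- apply: ladder_ext => k; apply: (pushout_ext (po k)).
    exact: (ladder_at ej k).
  exact: (ladder_at ev k).
have [k|k h h' [hj hv] [hj' hv']|h Hh] := @choose_ladder F l Z T
  (fun k h => h \oc j k = (x : ladder I T) k /\ h \oc v k = (y : ladder Y T) k).
- exact: pushout_desc (po k) (ladder_at e k).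
- apply: (pushout_ext (po (src k))).
    by rewrite -compA hj ld_comm -compA ld_comm compA hj'.
  by rewrite -compA hv ld_comm -compA ld_comm compA hv'.
by exists h; split; apply: ladder_ext => k; case: (Hh k).
Qed.

Lemma pushout_termwise (X I C Y Z : chain F l) (i : ladder X I) (p : ladder I C)
    (u : ladder X Y) (j : ladder I Z) (v : ladder Y Z) :
  cc (i : @Hom M X I) (p : @Hom M I C) -> @is_pushout M X I Y Z i u j v ->
  forall k, is_pushout (i k) (u k) (j k) (v k).
Proof.
move=> cp po k; have [Z' [j' [v' [q [po' _ _]]]]] := chain_pushout_ex u cp.
have [c [[c' [c'c cc']] cj cv]] := pushout_unique (termwise_pushout po') po.
rewrite -(ladder_at cj k) -(ladder_at cv k); apply: pushout_iso (po' k).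
by exists ((c' : ladder Z Z') k); split; [exact: ladder_at c'c k | exact: ladder_at cc' k].
Qed.

(** Reduces closure under cones to two-out-of-three in conflations. *)
Lemma standard_triangle_conf (X Y Z : M) (u : Hom X Y) (v : Hom Y Z)
    (w : Hom Z (hull_susp (the_hull cc X))) :
  standard_triangle u v w -> cc v w.
Proof.
move=> [j [po wj wv]] k; have [_ ch] := chain_hullP X.
apply: (conf_pushout (pushout_termwise ch po k) (ch k)).
  exact: ladder_at wj k.
exact: ladder_at wv k.
Qed.

(* A ladder with stably invertible terms is stably invertible, because its cone is
   termwise projective, hence projective. *)
Lemma pinfl_ladder_stab_iso (X Y : chain F l) (u : ladder X Y) :
  (forall k, pinfl (u k)) -> @isomorphic (stabCat cc) X Y.
Proof.
move=> pu; have [I [C [i [p [pI ci]]]]] := chain_enough_injectives hF X.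
have [Z [j [v [q [po _ _]]]]] := chain_pushout_ex u ci.
have pZ : projective cc (Z : M).
  apply: termwise_projective => // k.
  exact: (pinfl_target (pinfl_pushout (pushout_sym (po k)) (pu k)) (pI k)).
(* The projective cone splits the conflation from [X] to [biprod I Y] to [Z]; the component on [Y]
   of the retraction [r] is a stable inverse of [u]. *)
pose phi : @Hom M X (@biprod M I Y) :=
  @inl_ M I Y \oc (i : @Hom M X I) + @inr_ M I Y \oc (u : @Hom M X Y).
pose psi : @Hom M (@biprod M I Y) Z :=
  (j : @Hom M I Z) \oc @prl M I Y + (- (v : @Hom M Y Z)) \oc @prr M I Y.
have cphi : cc phi psi.
  move=> k; apply: (@conf_pushout_biprod F _ _ _ _ (u k) (i k) (v k) (j k)).
    by exists (C k), (p k).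
  exact: pushout_sym.
have [|s es] := pZ _ _ psi _ (idm (Z : M)); first by exists X, phi.
have [r [rphi e]] := chain_conf_section cphi es.
apply: (@stab_iso _ _ (X : M) (Y : M) u (r \oc @inr_ M I Y)).
  have -> : r \oc @inr_ M I Y \oc u - idm (X : M) = - (r \oc @inl_ M I Y) \oc (i : @Hom M X I).
    by rewrite -rphi compNm /phi compDr !compA opprD addrCA subrr addr0.
  by apply: factors_proj_through; apply: termwise_projective.
have -> : (u : @Hom M X Y) \oc (r \oc @inr_ M I Y) - idm (Y : M)
    = - (@prr M I Y \oc s) \oc (psi \oc @inr_ M I Y).
  have pphi : @prr M I Y \oc phi = u by rewrite /phi pair_prr.
  have -> : idm (Y : M) = @prr M I Y \oc (phi \oc r + s \oc psi) \oc @inr_ M I Y.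
    by rewrite e compm1 prr_inr.
  by rewrite compDr compDl !compA pphi opprD addrA subrr add0r !compNm.
by apply: factors_proj_through.
Qed.

(** [suspm] picks an unspecified value, so every [g] induced by a representative of the identity is
    compared with the identity; their difference factors through the injective hull. *)
Lemma suspm_id (X : M) : suspm (idm (X : stabCat cc)) = idm (susp (X : stabCat cc)).
Proof.
have [ih ch] := chain_hullP X.
rewrite /suspm; case: xgetP => [r _|] /=; last first.
  move=> /(_ (stab_pi cc (@idm M (hull_susp (the_hull cc X)))))[].
  exists (@idm M X), (@idm M _); split=> //.
  by exists (@idm M _); rewrite !compm1 !comp1m.
move=> [f [g [[h [hi gp]] ef <-]]].
have [P [a [b [pP e]]]] := (stab_pi_eq cc f (@idm M X)).1 ef.
apply/(stab_pi_eq cc g (@idm M _)).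
have iP : injective_ob cc P.
  by apply: termwise_injective => //; apply: projective_termwise.
have [|a' ea] := iP _ _ (hull_in (the_hull cc X)) _ a.
  by exists (hull_susp (the_hull cc X)), (hull_pr (the_hull cc X)).
(* Removing the part that comes from [P] leaves an endomorphism of the hull that vanishes on [X]. *)
have [|c ec] := @cokernel_lift _ _ _ _ _ _ _
  (h - @idm M _ - hull_in (the_hull cc X) \oc b \oc a') (chain_conf_cokernel ch).
  rewrite !compBl hi comp1m -!compA ea -e compBr compm1.
  by rewrite subrr.
have -> : g - @idm M _ = hull_pr (the_hull cc X) \oc c.
  apply: (cokernel_epi (chain_conf_cokernel ch)).
  rewrite compBl gp comp1m -compA ec compBr !compA.
  have -> : hull_pr (the_hull cc X) \oc hull_in (the_hull cc X) = 0.
    exact: (chain_conf_kernel ch).1.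
  by rewrite !comp0m subr0 compBr compm1.
apply: factors_proj_through; apply: termwise_projective => // k.
exact: hull_proj.
Qed.

(** Keeps the termwise pushouts that define the cone visible, as they control its terms and
    arrows. *)
Lemma triangle_ex (A X : chain F l) (u : ladder A X) :
  exists (I C Z : chain F l) (i : ladder A I) (p : ladder I C) (j : ladder I Z)
    (v : ladder X Z) (w : @Hom (stabCat cc) Z (susp (A : stabCat cc))),
  [/\ forall k, proj (I k), cc (i : @Hom M A I) (p : @Hom M I C),
      forall k, is_pushout (i k) (u k) (j k) (v k) &
      @distinguished (stabMor F l) A X Z (stab_pi cc (u : @Hom M A X))
        (stab_pi cc (v : @Hom M X Z)) w].
Proof.
have [_ ch] := chain_hullP A.
have [Z [j [v [q [po qj qv]]]]] := chain_pushout_ex u ch.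
exists (hull_ob (the_hull cc A)), (hull_susp (the_hull cc A)), Z,
  (hull_in (the_hull cc A)), (hull_pr (the_hull cc A)), j, v, (stab_pi cc (q : @Hom M Z _)).
split=> //; first exact: hull_proj.
exists A, X, Z, u, v, q,
  (idm (A : stabCat cc)), (idm (X : stabCat cc)), (idm (Z : stabCat cc)).
split; rewrite ?comp1m ?compm1 //.
- exists j; split; first exact: termwise_pushout.
    by apply: ladder_ext => k; apply: qj.
  by apply: ladder_ext => k; apply: qv.
- by split; apply: iso_id.
- by rewrite (suspm_id (A : M)) comp1m.
Qed.

End ChainTriangles.

(** * Semiorthogonal decompositions *)

Section Decompositions.
Local Open Scope ring_scope.
Variables (F : exactCat) (hF : frobenius F) (l : nat).
Local Notation infl := (inflation (@conf F)).
Local Notation defl := (deflation (@conf F)).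
Local Notation proj := (projective (@conf F)).
Local Notation M := (chainCat F l).
Local Notation cc := (@chain_conf F l).

Lemma cone_standard (X Y Z : stabCat cc) (u : Hom X Y) (v : Hom Y Z) (w : Hom Z (susp X)) :
  stab_distinguished u v w ->
  exists (X' Y' Z' : M) (u' : Hom X' Y') (v' : Hom Y' Z')
    (w' : Hom Z' (hull_susp (the_hull cc X'))),
  [/\ @isomorphic (stabCat cc) X X', @isomorphic (stabCat cc) Y Y',
      @isomorphic (stabCat cc) Z' Z & standard_triangle u' v' w'].
Proof.
move=> [X' [Y' [Z' [u' [v' [w' [a [b [c [st [Ia Ib Ic] _ _ _]]]]]]]]]].
exists X', Y', Z', u', v', w'; split=> //; [by exists a | by exists b |].
by apply: isomorphic_sym; exists c.
Qed.

(** Biproducts come from split conflations, both shifts from the conflation of the hull, and cones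
    from [standard_triangle_conf]. *)
Lemma triangulated_criterion (U : chain F l -> Prop) :
  (forall X : chain F l, (forall k, proj (X k)) -> U X) ->
  (forall X Y : chain F l, @isomorphic (stabCat cc) X Y -> U X -> U Y) ->
  (forall (X Y Z : chain F l) (f : ladder X Y) (g : ladder Y Z),
    cc (f : @Hom M X Y) (g : @Hom M Y Z) ->
    [/\ U X -> U Z -> U Y, U X -> U Y -> U Z & U Y -> U Z -> U X]) ->
  triangulated_subcat (U : subcat (stabMor F l)).
Proof.
move=> Uproj Uiso U23; split=> //.
- by apply: Uproj => k; apply: projective_zob.
- move=> X Y UX UY.
  have [h _ _] := U23 X (chain_biprod X Y) Y (chain_inl X Y) (chain_prr X Y)
    (fun k => conf_inl _ _).
  exact: h.
- move=> X UX; have [_ ch] := chain_hullP hF X; have [_ h _] := U23 _ _ _ _ _ ch.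
  by apply: h => //; apply: Uproj; exact: hull_proj.
- move=> X UX; have [_ ch] := chain_hullP hF X; have [_ _ h] := U23 _ _ _ _ _ ch.
  by apply: h => //; apply: Uproj; exact: hull_proj.
move=> X Y Z u v w /cone_standard[X' [Y' [Z' [u' [v' [w' [XX' YY' Z'Z st]]]]]]] UX UY.
have UX' := Uiso _ _ XX' UX; have UY' := Uiso _ _ YY' UY; apply: (Uiso _ _ Z'Z).
have [h _ _] := U23 _ _ _ _ _ (standard_triangle_conf hF st).
apply: h => //; have [_ ch] := chain_hullP hF X'; have [_ h' _] := U23 _ _ _ _ _ ch.
by apply: h' => //; apply: Uproj; exact: hull_proj.
Qed.

Lemma stab_iso_proj (X Y : chain F l) (k : 'I_l.+1) :
  @isomorphic (stabCat cc) X Y -> proj (X k) -> proj (Y k).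
Proof.
move=> /stab_isoE[f [g [_ fg]]] pX; apply: (@projective_null _ _ _).
have := null_termwise hF fg k => /= n.
have -> : idm (Y k) = (f : ladder X Y) k \oc (g : ladder Y X) k
    - ((f : ladder X Y) k \oc (g : ladder Y X) k - idm (Y k)) by rewrite opprB addrC subrK.
by apply: factors_projB n; apply: factors_proj_through.
Qed.

Lemma Gamma_triangulated a b : triangulated_subcat (Gamma F l a b).
Proof.
apply: triangulated_criterion.
- by move=> X pX k _.
- by move=> X Y XY UX k kab; apply: (stab_iso_proj XY); apply: UX.
move=> X Y Z f g cg; split=> U1 U2 k kab.
- exact: proj_ext (cg k) (U1 k kab) (U2 k kab).
- exact: proj_quot (cg k) (U1 k kab) (U2 k kab).
- exact: proj_sub (cg k) (U1 k kab) (U2 k kab).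
Qed.

Lemma is_idm_iso (A B : F) (f : Hom A B) : is_idm f -> is_iso f.
Proof. by case: B f /; apply: iso_id. Qed.

(** [Y] repeats the term of [X] at [a] up to position [b] and agrees with [X] elsewhere; [y]
    consists of composites of arrows of [X]. The second clause serves for cones, the third for
    describing [Delta]. *)
Lemma constant_subchain (X : chain F l) (a b : nat) :
  exists (Y : chain F l) (y : ladder Y X),
  [/\ forall k : 'I_l, (a <= k < b)%N -> is_idm (ch_map Y k),
      forall k : 'I_l.+1, ~~ (a < k <= b)%N -> pinfl (y k) &
      (forall k : 'I_l, (a <= k < b)%N -> pinfl (ch_map X k)) -> forall k, pinfl (y k)].
Proof.
pose T k := {A : F & Hom A (X k)}.
pose stable := forall k : 'I_l, (a <= k < b)%N -> pinfl (ch_map X k).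
pose Inv k (t : T k) := [/\ infl (projT2 t), ~~ (a < k <= b)%N -> pinfl (projT2 t) &
  stable -> pinfl (projT2 t)].
pose R (k : 'I_l) (t : T (src k)) (t' : T (tgt k)) :=
  exists h : Hom (projT1 t) (projT1 t'), [/\ infl h,
    ch_map X k \oc projT2 t = projT2 t' \oc h & (a <= k < b)%N -> is_idm h].
have [|k _ [A y] [/= iy py sy]|//|t [It /dependent_choice_fam[h Hh]]] :=
  @chain_choice l ord0 T Inv R.
- by exists (existT _ (X ord0) (idm _)); split=> /= *;
    do ?[apply: pinfl_infl]; apply: pinfl_id.
- case: (boolP (a <= k < b)%N) => kab.
    exists (existT _ A (ch_map X k \oc y)); split.
      split=> /=; first by apply: (infl_comp (exactP F)) iy (ch_infl X k).
        by move: kab; rewrite bump0 ltnS => ->.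
      by move=> st; apply: pinfl_comp (sy st) _; apply: st.
    exists (idm A); split; [exact: infl_id (exactP F) _ | by rewrite compm1 |].
    by move=> _; constructor.
  exists (existT _ (X (tgt k)) (idm _)); split.
    by split=> /= *;
    do ?[apply: pinfl_infl]; apply: pinfl_id.
  exists (ch_map X k \oc y); split; [| by rewrite comp1m | by rewrite (negPf kab)].
  exact: (infl_comp (exactP F)) iy (ch_infl X k).
pose Y := @Chain F l (fun k => projT1 (t k)) h (fun k => let: And3 e _ _ := Hh k in e).
exists Y, (@Ladder F l Y X (fun k => projT2 (t k)) (fun k => let: And3 _ e _ := Hh k in e)).
split=> /= [k|k|st k]; first by case: (Hh k).
  by case: (It k).
by case: (It k) => _ _; apply.
Qed.

(** Passing to a stably isomorphic chain with identity arrows inverts the arrows of [X] stably, so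
    [pinfl_stab_iso] applies. Conversely [constant_subchain] gives a termwise trivial ladder, a
    stable isomorphism. *)
Lemma Delta_pinfl (X : chain F l) (a b : nat) :
  Delta F l a b X <-> forall k : 'I_l, (a <= k < b)%N -> pinfl (ch_map X k).
Proof.
split=> [[Y [/stab_isoE[f [g [gf _]]] idY]] k kab|st]; last first.
  have [Y [y [idY _ /(_ st) py]]] := constant_subchain X a b.
  by exists Y; split=> //; apply: isomorphic_sym; apply: pinfl_ladder_stab_iso py.
have [b' [b'b bb']] := is_idm_iso (idY k kab).
move: f g gf => /= f g /(null_termwise hF) gf.
(* The stable inverse of the arrow goes to [Y], back along its identity arrow, and returns to
   [X]. *)
apply: (pinfl_stab_iso hF (r := g (src k) \oc b' \oc f (tgt k)) (ch_infl X k)).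
  by rewrite -!compA -ld_comm (comp_pre b'b) comp1m; exact: gf (src k).
by rewrite !compA ld_comm -(compA _ _ b') bb' compm1; exact: gf (tgt k).
Qed.

Lemma Delta_triangulated a b : triangulated_subcat (Delta F l a b).
Proof.
apply: triangulated_criterion.
- move=> X pX; apply/Delta_pinfl => k _; apply: pinfl_proj => //; exact: ch_infl.
- move=> X Y XY [Z [XZ idZ]]; exists Z; split=> //.
  exact: isomorphic_trans (isomorphic_sym XY) XZ.
move=> X Y Z f g cg.
split=> /Delta_pinfl U1 /Delta_pinfl U2; apply/Delta_pinfl => k kab;
  have := (U1 k kab, U2 k kab) => -[p1 p2]; have ef := ld_comm f k; have eg := ld_comm g k.
- exact: (pinfl_middle (cg (src k)) (cg (tgt k)) ef eg p1 p2).
- exact: (pinfl_right hF (cg (src k)) (cg (tgt k)) ef eg (ch_infl Z k) p1 p2).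
- exact: (pinfl_left (cg (src k)) (cg (tgt k)) ef eg (ch_infl X k) p1 p2).
Qed.

(** * Vanishing of morphisms between the classes *)

Lemma stab_hom0 (X X' Y Y' : chain F l) :
  @isomorphic (stabCat cc) X X' -> @isomorphic (stabCat cc) Y Y' ->
  (forall f : ladder X' Y', factors_proj cc (f : @Hom M X' Y')) ->
  forall f : @Hom (stabCat cc) X Y, f = 0.
Proof.
move=> [x [x' [x'x _]]] [y [y' [y'y _]]] H f.
have z (g : @Hom (stabCat cc) X' Y') : g = 0.
  have := H (repr g); rewrite -[X in factors_proj _ X](subr0 (repr g : @Hom M X' Y')).
  by move=> /stab_pi_eq; rewrite stab_pi_repr stab_pi0.
rewrite -[f]compm1 -x'x -[f]comp1m -y'y.
by rewrite -!compA (compA f) (compA y) (z (y \oc (f \oc x'))) comp0m compm0.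
Qed.

Lemma factors_proj_termwise (X Y : chain F l) (f : ladder X Y)
    (t : forall k, {P : F & (Hom (X k) P * Hom P (Y k))%type}) :
  (forall k, proj (projT1 (t k)) /\ (projT2 (t k)).2 \oc (projT2 (t k)).1 = f k) ->
  (forall k : 'I_l, exists h : Hom (projT1 (t (src k))) (projT1 (t (tgt k))),
    [/\ infl h, h \oc (projT2 (t (src k))).1 = (projT2 (t (tgt k))).1 \oc ch_map X k &
        ch_map Y k \oc (projT2 (t (src k))).2 = (projT2 (t (tgt k))).2 \oc h]) ->
  factors_proj cc (f : @Hom M X Y).
Proof.
move=> Ht /dependent_choice_fam[h Hh].
pose P := @Chain F l (fun k => projT1 (t k)) h (fun k => let: And3 e _ _ := Hh k in e).
exists P, (@Ladder F l X P (fun k => (projT2 (t k)).1)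
    (fun k => let: And3 _ e _ := Hh k in e)),
  (@Ladder F l P Y (fun k => (projT2 (t k)).2) (fun k => let: And3 _ _ e := Hh k in e)).
split; first by apply: termwise_projective => // k; case: (Ht k).
by apply: ladder_ext => k /=; case: (Ht k).
Qed.

(** Built downwards from [l], which lies outside [[a, b]] as [b < l]: the projective chain has the
    term of [X] outside [[a, b]] and that of [X] at [b + 1] inside, mapped to [Y] through its
    inverted arrows. *)
Lemma hom_Gamma_Delta (X Y : chain F l) (a b : nat) (f : ladder X Y) : (b < l)%N ->
  Gamma F l a b X -> (forall k : 'I_l, (a <= k < b.+1)%N -> is_idm (ch_map Y k)) ->
  factors_proj cc (f : @Hom M X Y).
Proof.
move=> bl GX idY.
pose T k := {P : F & (Hom (X k) P * Hom P (Y k))%type}.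
pose Inv k (t : T k) := [/\ proj (projT1 t), (projT2 t).2 \oc (projT2 t).1 = f k &
  infl (projT2 t).1].
pose R (k : 'I_l) (t : T (src k)) (t' : T (tgt k)) :=
  exists h : Hom (projT1 t) (projT1 t'), [/\ infl h,
    h \oc (projT2 t).1 = (projT2 t').1 \oc ch_map X k &
    ch_map Y k \oc (projT2 t).2 = (projT2 t').2 \oc h].
have [|k lk|k _ [P [x y]] [/= pP yx ix]|t [It Rt]] := @chain_choice l ord_max T Inv R.
- exists (existT _ (X ord_max) (idm _, f ord_max)); split=> /=.
  + by apply: GX; rewrite /= bl orbT.
  + exact: compm1.
  + exact: infl_id (exactP F) _.
- by move: lk; rewrite /= leqNgt ltn_ord.
- have ixa := infl_comp (exactP F) (ch_infl X k) ix.
  case: (boolP (a <= k < b.+1)%N) => kab.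
    have [b' [b'b bb']] := is_idm_iso (idY k kab).
    exists (existT _ P (x \oc ch_map X k, b' \oc y)); split.
      split=> //=.
      by rewrite -!compA (compA y) yx -ld_comm (comp_pre b'b) comp1m.
    exists (idm P); split=> /=; [exact: infl_id (exactP F) _ | exact: comp1m |].
    by rewrite compm1 compA bb' comp1m.
  exists (existT _ (X (src k)) (idm _, f (src k))); split.
    split=> /=; [|exact: compm1 | exact: infl_id (exactP F) _].
    by apply: GX; move: kab; rewrite negb_and -ltnNge -leqNgt.
  exists (x \oc ch_map X k); split=> //=; first exact: compm1.
  by rewrite compA yx ld_comm.
by apply: factors_proj_termwise Rt => k; case: (It k).
Qed.

(** Built upwards from position zero: the projective chain has the term of [Y] outside [[a + 1, b]]
    and that of [Y] at [a] inside. *)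
Lemma hom_Delta_Gamma (X Y : chain F l) (a b : nat) (f : ladder X Y) :
  (forall k : 'I_l, (a <= k < b)%N -> is_idm (ch_map X k)) -> Gamma F l a.+1 b Y ->
  factors_proj cc (f : @Hom M X Y).
Proof.
move=> idX GY.
pose T k := {P : F & (Hom (X k) P * Hom P (Y k))%type}.
pose Inv k (t : T k) := [/\ proj (projT1 t), (projT2 t).2 \oc (projT2 t).1 = f k &
  infl (projT2 t).2].
pose R (k : 'I_l) (t : T (src k)) (t' : T (tgt k)) :=
  exists h : Hom (projT1 t) (projT1 t'), [/\ infl h,
    h \oc (projT2 t).1 = (projT2 t').1 \oc ch_map X k &
    ch_map Y k \oc (projT2 t).2 = (projT2 t').2 \oc h].
have [|k _ [P [x y]] [/= pP yx iy]|//|t [It Rt]] := @chain_choice l ord0 T Inv R.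
- exists (existT _ (Y ord0) (f ord0, idm _)); split=> /=.
  + by apply: GY.
  + exact: comp1m.
  + exact: infl_id (exactP F) _.
- have iyb := infl_comp (exactP F) iy (ch_infl Y k).
  case: (boolP (a <= k < b)%N) => kab.
    have [a' [a'a aa']] := is_idm_iso (idX k kab).
    exists (existT _ P (x \oc a', ch_map Y k \oc y)); split.
      split=> //=.
      by rewrite -!compA (compA y) yx compA ld_comm -compA aa' compm1.
    exists (idm P); split=> /=; [exact: infl_id (exactP F) _ | | by rewrite compm1].
    by rewrite comp1m -compA a'a compm1.
  exists (existT _ (Y (tgt k)) (f (tgt k), idm _)); split.
    split=> /=; [|exact: comp1m | exact: infl_id (exactP F) _].
    by apply: GY; move: kab; rewrite tgtE ltnS negb_and -ltnNge -leqNgt.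
  exists (ch_map Y k \oc y); split=> //=; last by rewrite comp1m.
  by rewrite -compA yx ld_comm.
by apply: factors_proj_termwise Rt => k; case: (It k).
Qed.

(** Each step adds a summand [Q] to the projective: the old summand carries an extension of the
    previous map, and [Q] carries the difference [d] from [f]. *)
Lemma hom_Gamma_Gamma (X Y : chain F l) (a : nat) (f : ladder X Y) :
  Gamma F l a.+1 l X -> Gamma F l 0 a Y -> factors_proj cc (f : @Hom M X Y).
Proof.
move=> GX GY.
pose T k := {P : F & (Hom (X k) P * Hom P (Y k))%type}.
pose Inv k (t : T k) := proj (projT1 t) /\ (projT2 t).2 \oc (projT2 t).1 = f k.
pose R (k : 'I_l) (t : T (src k)) (t' : T (tgt k)) :=
  exists h : Hom (projT1 t) (projT1 t'), [/\ infl h,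
    h \oc (projT2 t).1 = (projT2 t').1 \oc ch_map X k &
    ch_map Y k \oc (projT2 t).2 = (projT2 t').2 \oc h].
have [|k _ [P [x y]] [/= pP yx]|//|t [It Rt]] := @chain_choice l ord0 T Inv R.
- exists (existT _ (X ord0) (idm _, f ord0)); split=> /=; last exact: compm1.
  by apply: GX.
- have [z ez] := proj_extend hF x pP (ch_infl X k).
  pose d := f (tgt k) - ch_map Y k \oc y \oc z.
  have da : d \oc ch_map X k = 0.
    by rewrite /d compBl -!compA ez yx ld_comm subrr.
  (* [d] factors through a projective by a map that still kills [X (src k)]. *)
  have [Q [d1 [d2 [pQ d1a ed]]]] :
    exists (Q : F) (d1 : Hom (X (tgt k)) Q) (d2 : Hom Q (Y (tgt k))),
      [/\ proj Q, d1 \oc ch_map X k = 0 & d2 \oc d1 = d].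
    case: (leqP k.+1 a) => ka.
      (* Up to [a] the arrow of [X] starts at an injective, hence splits, and
         [idm _ - ch_map X k \oc r] kills its source. *)
      have [|r er] := proj_extend hF (idm (X (src k))) _ (ch_infl X k).
        by apply: GX => /=; rewrite ltnS (ltnW ka).
      exists (X (tgt k)), (idm _ - ch_map X k \oc r), d; split.
      + by apply: GX; rewrite tgtE ltnS ka.
      + by rewrite compBl comp1m -compA er compm1 subrr.
      + by rewrite compBr compm1 compA da comp0m subr0.
    exists (Y (tgt k)), d, (idm _); split=> //; last exact: comp1m.
    by apply: GY; rewrite tgtE ka orbT.
  exists (existT _ (biprod P Q) (inl_ P Q \oc z + inr_ P Q \oc d1,
    (ch_map Y k \oc y) \oc prl P Q + d2 \oc prr P Q)); split.
    split=> /=; first exact: projective_biprod.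
    by rewrite copair_pair ed /d addrC subrK.
  exists (inl_ P Q); split=> /=; first exact: infl_inl.
    by rewrite compDl -!compA ez d1a compm0 addr0.
  by rewrite copair_inl.
by apply: factors_proj_termwise Rt => k; case: (It k).
Qed.

(** * The three kinds of semiorthogonal pairs *)

Lemma zero_ob_proj (A : F) : idm A = 0 -> proj A.
Proof.
by move=> A0; apply: (@projective_retract _ _ zob A 0 0);
  [rewrite comp0m | exact: projective_zob].
Qed.

Lemma infl_zero_ob (A B : F) (f : Hom A B) : idm A = 0 -> infl f.
Proof.
move=> A0; have -> : f = (0 : Hom zob B) \oc (0 : Hom A zob).
  by rewrite comp0m -[f]compm1 A0 compm0.
apply: (infl_comp (exactP F)); last by exists B, (idm B); exact: conf_0id.
by apply: infl_iso; exists 0; rewrite !comp0m A0 zobP.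
Qed.

Lemma sod_Gamma_Gamma (a : nat) :
  semiorthogonal_decomposition (Gamma F l a.+1 l) (Gamma F l 0 a).
Proof.
split; try exact: Gamma_triangulated.
  move=> X Y GX GY; apply: (@stab_hom0 X X Y Y).
  - by exists (idm _); apply: iso_id.
  - by exists (idm _); apply: iso_id.
  - by move=> f; apply: hom_Gamma_Gamma GX GY.
move=> X.
pose T k := {A : F & Hom A ((X : chain F l) k)}.
(* A zero term is recorded by [idm = 0], which avoids an equality of objects. *)
pose Inv k (t : T k) := ((k <= a)%N -> idm (projT1 t) = 0) /\ ((a < k)%N -> pinfl (projT2 t)).
pose R (k : 'I_l) (t : T (src k)) (t' : T (tgt k)) :=
  exists h : Hom (projT1 t) (projT1 t'), infl h /\
    ch_map (X : chain F l) k \oc projT2 t = projT2 t' \oc h.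
have [|k _ [A y] [/= zA py]|//|t [It /dependent_choice_fam[h Hh]]] :=
  @chain_choice l ord0 T Inv R.
- by exists (existT _ zob (0 : Hom zob ((X : chain F l) ord0))); split=> //= _; exact: zobP.
- case: (leqP k.+1 a) => ka.
    exists (existT _ zob (0 : Hom zob ((X : chain F l) (tgt k)))); split.
      by split=> /= [_|]; [exact: zobP | rewrite bump0 ltnNge ka].
    exists 0; split; first by apply: infl_zero_ob; apply: zA; apply: ltnW.
    rewrite /= comp0m; have -> : y = 0 by rewrite -[y]compm1 zA ?compm0 // ltnW.
    by rewrite compm0.
  exists (existT _ ((X : chain F l) (tgt k)) (idm _)); split.
    split=> /=; first by rewrite bump0 leqNgt ka.
    by move=> _; apply: pinfl_id.
  exists (ch_map (X : chain F l) k \oc y); split; last by rewrite comp1m.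
  (* The arrow out of position [a] starts at a zero object; beyond [a] the ladder is an
     inflation. *)
  move: ka; rewrite ltnS leq_eqVlt => /orP[/eqP ka|ka].
    by apply: infl_zero_ob; apply: zA; rewrite ka.
  by apply: (infl_comp (exactP F)) (ch_infl _ _); apply: pinfl_infl; apply: py.
pose A := @Chain F l (fun k => projT1 (t k)) h (fun k => (Hh k).1).
pose u := @Ladder F l A X (fun k => projT2 (t k)) (fun k => (Hh k).2).
have [I [C [Z [i [p [j [v [w [pI ci po dist]]]]]]]]] := triangle_ex hF u.
exists A, Z, (stab_pi cc (u : @Hom M A X)), (stab_pi cc (v : @Hom M X Z)), w; split=> //.
  move=> k; rewrite [(l < k)%N]ltnNge -(ltnS k) ltn_ord orbF ltnS => ka.
  by apply: zero_ob_proj; apply: (It k).1.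
move=> k; rewrite ltn0 /= => ka.
(* The map from the projective [I k] to the cone is a pushout of [u k], so the cone is projective
   where [u k] is a [pinfl]. *)
by apply: (pinfl_target (pinfl_pushout (pushout_sym (po k)) _) (pI k)); apply: (It k).2.
Qed.

Lemma sod_Delta_Gamma (a b : nat) :
  semiorthogonal_decomposition (Delta F l a b) (Gamma F l a.+1 b).
Proof.
split; [exact: Delta_triangulated | exact: Gamma_triangulated | |].
  move=> X Y [X' [XX' idX]] GY; apply: (@stab_hom0 X X' Y Y) => //.
  - by exists (idm _); apply: iso_id.
  - by move=> f; apply: hom_Delta_Gamma idX GY.
move=> X; have [A [u [idA pu _]]] := constant_subchain X a b.
have [I [C [Z [i [p [j [v [w [pI ci po dist]]]]]]]]] := triangle_ex hF u.
exists A, Z, (stab_pi cc (u : @Hom M A X)), (stab_pi cc (v : @Hom M X Z)), w; split=> //.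
  by exists A; split=> //; exists (idm _); apply: iso_id.
move=> k kab.
apply: (pinfl_target (pinfl_pushout (pushout_sym (po k)) _) (pI k)); apply: pu.
by rewrite negb_and -leqNgt -ltnNge -ltnS.
Qed.

Lemma sod_Gamma_Delta (a b : nat) : (a <= b.+1)%N -> (b < l)%N ->
  semiorthogonal_decomposition (Gamma F l a b) (Delta F l a b.+1).
Proof.
move=> ab bl; split; [exact: Gamma_triangulated | exact: Delta_triangulated | |].
  move=> X Y GX [Y' [YY' idY]]; apply: (@stab_hom0 X X Y Y') => //.
  - by exists (idm _); apply: iso_id.
  - by move=> f; apply: hom_Gamma_Delta bl GX idY.
move=> X.
pose T k := {A : F & Hom A ((X : chain F l) k)}.
(* [A] is constant and projective from [b + 1] on, made of pullbacks from [b] down to [a], and zero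
   below [a]. At the starting position [b + 1] the last clause is void because [a <= b.+1]. *)
pose Inv k (t : T k) := [/\ (b < k)%N -> proj (projT1 t),
  (a <= k <= b.+1)%N -> defl (projT2 t) & (k < a)%N -> idm (projT1 t) = 0].
pose R (k : 'I_l) (t : T (src k)) (t' : T (tgt k)) :=
  exists h : Hom (projT1 t) (projT1 t'), [/\ infl h,
    ch_map (X : chain F l) k \oc projT2 t = projT2 t' \oc h &
    (a <= k <= b)%N -> is_pushout h (projT2 t) (projT2 t') (ch_map (X : chain F l) k)].
pose b1 : 'I_l.+1 := @Ordinal l.+1 b.+1 bl.
have [|k bk [A y] [/= pA dy _]|k kb [A' y'] [/= _ dy' _]|
    t [It /dependent_choice_fam[h Hh]]] := @chain_choice l b1 T Inv R.
- have [P [q [pP dq]]] := exists_proj_defl hF ((X : chain F l) b1).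
  by exists (existT _ P q); split=> //=; rewrite ltnNge ab.
- have bk' : (b < k)%N by [].
  exists (existT _ A (ch_map (X : chain F l) k \oc y)); split.
    split=> /=; first by move=> _; apply: pA.
      by rewrite bump0 ltnS [(k <= b)%N]leqNgt bk' andbF.
    by rewrite bump0 ltnNge (leq_trans ab) // ltnW.
  exists (idm A); split; [exact: infl_id (exactP F) _ | by rewrite compm1 |].
  by rewrite [(k <= b)%N]leqNgt bk' andbF.
- have kb' : (k <= b)%N by [].
  case: (leqP a k) => ak; last first.
    exists (existT _ zob (0 : Hom zob ((X : chain F l) (src k)))); split.
      split=> /=; last by move=> _; exact: zobP.
        by rewrite ltnNge kb'.
      by rewrite leqNgt ak.
    exists 0; split; first by apply: infl_zero_ob; exact: zobP.
      by rewrite /= !compm0.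
    by rewrite leqNgt ak.
  have {}dy' : defl y' by apply: dy'; rewrite bump0 ltnS kb' andbT ltnW.
  (* Pulling back along the arrow of [X] gives an inflation [c] with the same cokernel [K] and a
     deflation [y], in a square that is also a pushout. *)
  have [K [e ce]] := ch_infl (X : chain F l) k.
  have [A [c [y [pb dy]]]] := defl_pull (exactP F) (ch_map (X : chain F l) k) dy'.
  exists (existT _ A y); split.
    by split=> //=; [rewrite ltnNge kb' | rewrite ltnNge ak].
  exists c; split=> /=; [|by rewrite pb.1|by move=> _; apply: pullback_pushout pb].
  by exists K, (e \oc y'); apply: conf_pullback ce dy' pb.
pose A := @Chain F l (fun k => projT1 (t k)) h (fun k => let: And3 e _ _ := Hh k in e).
pose u := @Ladder F l A X (fun k => projT2 (t k)) (fun k => let: And3 _ e _ := Hh k in e).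
have [I [C [Z [i [p [j [v [w [pI ci po dist]]]]]]]]] := triangle_ex hF u.
exists A, Z, (stab_pi cc (u : @Hom M A X)), (stab_pi cc (v : @Hom M X Z)), w; split=> //.
  move=> k kab; have [pA _ zA] := It k.
  by case/orP: kab => [/zA/zero_ob_proj|/pA].
apply/Delta_pinfl => k kab; have [_ _ pX] := Hh k.
(* Over a bicartesian square of [u] the arrow of the cone is a pushout of the arrow of [I], an
   inflation between projectives. *)
apply: pinfl_pushout (pushout_cube (po (src k)) (po (tgt k)) (pX kab) _ _ _) _.
- exact: ld_comm.
- by rewrite ld_comm.
- by rewrite ld_comm.
- by apply: pinfl_proj => //; exact: ch_infl.
Qed.

End Decompositions.

(** * The polygon *)

Section ConsecutivePairs.
Variables (T : Type) (R : T -> T -> Prop).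

(** The analogue of [path] for a relation with values in [Prop]. *)
Fixpoint linked (x : T) (s : seq T) : Prop :=
  if s is y :: s' then R x y /\ linked y s' else True.

Lemma linked_cat x s1 s2 : linked x (s1 ++ s2) <-> linked x s1 /\ linked (last x s1) s2.
Proof. elim: s1 x => [|y s IH] x /=; first by intuition. have := IH y; intuition. Qed.

Lemma linked_nth x0 x s i : linked x s -> i < size s ->
  R (nth x0 (x :: s) i) (nth x0 (x :: s) i.+1).
Proof.
elim: s x i => [//|y s IH] x [|i] /= [xy ys] il; first by [].
exact: IH.
Qed.

(** One brace of the list, linked to the entry [x] before it. With [n.+1] blocks it is never empty,
    so its last entry is known and the next link can start there. *)
Lemma linked_alternating (D G : nat -> T) x m n :
  R x (D m) -> (forall k, m <= k <= m + n -> R (D k) (G k)) ->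
  (forall k, m <= k < m + n -> R (G k) (D k.+1)) ->
  let s := flatten [seq [:: D k; G k] | k <- iota m n.+1] in
  [/\ linked x s, size s = n.+1.*2 & forall y, last y s = G (m + n)].
Proof.
elim: n x m => [|n IH] x m xD DG GD.
  split=> //=; last by move=> y; rewrite addn0.
  by split=> //; split=> //; apply: DG; rewrite leqnn leq_addr.
have [|k /andP[mk kn]|k /andP[mk kn]|ls ss es] := IH (G m) m.+1.
- by apply: GD; rewrite leqnn addnS ltnS leq_addr.
- by apply: DG; rewrite addnS -addSn kn ltnW.
- by apply: GD; rewrite addnS -addSn kn ltnW.
set t := flatten _ in ls ss es.
suff: [/\ linked x (D m :: G m :: t), size (D m :: G m :: t) = n.+2.*2 &
  forall y, last y (D m :: G m :: t) = G (m + n.+1)] by [].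
clearbody t; split=> /= [||y]; [|by rewrite ss|by rewrite es addnS].
by split=> //; split=> //; apply: DG; rewrite leqnn leq_addr.
Qed.

End ConsecutivePairs.

Theorem theorem2 (F : exactCat) (hF : frobenius F) (l s : nat) (hs : s < l) :
  ngon_of_recollements (2 * l + 4)
    (Gamma F l 0 s ::
     flatten [seq [:: Delta F l k (k + s + 1); Gamma F l (k + 1) (k + s + 1)]
             | k <- iota 0 (l - s)] ++
     Gamma F l 0 (l - s - 1) ::
     flatten [seq [:: Delta F l k (k + l - s); Gamma F l (k + 1) (k + l - s)]
             | k <- iota 0 s.+1]).
Proof.
pose SOD := @semiorthogonal_decomposition (stabMor F l).
(* The bounds are freed up to equations, to match the arithmetic expressions of the list. *)
have GD a b b' : a <= b.+1 -> b < l -> b' = b.+1 -> SOD (Gamma F l a b) (Delta F l a b').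
  by move=> ab bl ->; apply: sod_Gamma_Delta.
have DG a a' b : a' = a.+1 -> SOD (Delta F l a b) (Gamma F l a' b).
  by move=> ->; apply: sod_Delta_Gamma.
have GG a a' l' : a' = a.+1 -> l' = l -> SOD (Gamma F l a' l') (Gamma F l 0 a).
  by move=> -> ->; apply: sod_Gamma_Gamma.
have [n ln] : exists n, l - s = n.+1 by exists (l - s).-1; rewrite prednK // subn_gt0.
have el : l = n.+1 + s by rewrite -ln subnK // ltnW.
have [|||l1 s1 e1] := @linked_alternating _ SOD (fun k => Delta F l k (k + s + 1))
  (fun k => Gamma F l (k + 1) (k + s + 1)) (Gamma F l 0 s) 0 n.
- by apply: GD => //; rewrite add0n addn1.
- by move=> k _; apply: DG; rewrite addn1.
- move=> k /andP[_ kn]; rewrite !addn1; apply: GD.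
  + by rewrite ltnS (leq_trans (leq_addr s k)) // leqW.
  + by rewrite el addSn ltnS -addSn leq_add2r.
  + by rewrite addSn.
have [|||l2 s2 e2] := @linked_alternating _ SOD (fun k => Delta F l k (k + l - s))
  (fun k => Gamma F l (k + 1) (k + l - s)) (Gamma F l 0 (l - s - 1)) 0 s.
- by apply: GD; rewrite ?ln ?subn1 //= ?add0n // el addSn ltnS leq_addr.
- by move=> k _; apply: DG; rewrite addn1.
(* Since [l - s = n.+1], the truncated subtraction in the upper bound is the sum [k + n.+1]. *)
- move=> k /andP[_ ks]; rewrite addn1; have e : k + l - s = k + n.+1.
    by rewrite el addnA addnK.
  rewrite addSn subSn ?e //; last by rewrite el addSn addnS leqW // addnA leq_addl.
  apply: GD => //; first by rewrite addnS ltnS leqW // leq_addr.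
  by rewrite el addnC ltn_add2l.
rewrite -ln in s1 l1 e1.
set s1' := flatten _ in l1 s1 e1 *; set s2' := flatten _ in l2 s2 e2 *.
clearbody s1' s2'.
(* Without its head the list has [2 (l - s) + 1 + 2 (s + 1)] entries. *)
have sz : size (s1' ++ Gamma F l 0 (l - s - 1) :: s2') = (2 * l + 3).
  by rewrite size_cat /= s1 s2 ln el mul2n doubleD (doubleS s) -addnA addn3.
have lk : linked SOD (Gamma F l 0 s) (s1' ++ Gamma F l 0 (l - s - 1) :: s2').
  (* The first brace ends with [Gamma] on [[l - s, l]], which meets [Gamma] on [[0, l - s - 1]] in a
     pair of the third kind. *)
  apply/linked_cat; split=> //; split=> //; rewrite e1; apply: GG.
    by rewrite ln subn1 addn1.
  by rewrite add0n el addn1 addSn.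
split; first by rewrite addn4.
  by rewrite /= sz !addnS.
move=> i il; have [il'|] := ltnP i (2 * l + 3).
  rewrite modn_small; last by rewrite addnS.
  by apply: linked_nth => //; rewrite sz.
(* At the last index [2 * l + 3] the successor wraps to the head: [Gamma] on [[s + 1, l]] is
   followed by [Gamma] on [[0, s]]. *)
rewrite leq_eqVlt => /orP[/eqP <-|]; last by rewrite ltnNge -ltnS -addnS il.
rewrite -addnS modnn.
by rewrite -sz -last_nth last_cat /= e2; apply: GG; rewrite ?add0n ?addn1 // addnC addnK.
Qed.
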